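(* Let $W\subseteq\mathrm{GL}(\mathfrak{h})$ be an irreducible complex reflection group. For all $c\in\mathcal{C}$ and $g\in G_W$ we have an equality of (non-unital) subalgebras of the algebra $D(\mathfrak{h}^\circ)\rtimes W$: $$eH_ce=eH_{g\cdot c}e.$$
   Context: $\mathcal{A}$ is the set of reflecting hyperplanes of $W$; for $H\in\mathcal{A}$, $W_H$ is the pointwise stabilizer of $H$ (cyclic), $n_H=|W_H|$, $\alpha_H\in\mathfrak{h}^*$ has zero set $H$, and $e_{H,j}=\frac1{n_H}\sum_{w\in W_H}\det^{-j}(w)\,w$, where $\det$ is the determinant character of $W\subseteq\mathrm{GL}(\mathfrak{h})$. $\mathfrak{h}^\circ$ is the complement of the reflecting hyperplanes in $\mathfrak{h}$, $D(\mathfrak{h}^\circ)$ is its algebra of algebraic differential operators, and $D(\mathfrak{h}^\circ)\rtimes W$ is the algebra of operators generated by it and $W$. $\mathcal{C}$ is the space of tuples $c=(c_{H,j})_{H\in\mathcal{A},0\le j\le n_H-1}$ of complex numbers with $c_{w(H),j}=c_{H,j}$ for all $w\in W$. $G_W$ is the group of tuples $s=(s_H)_{H\in\mathcal{A}}$ with $s_H$ a permutation of $\{0,\dots,n_H-1\}$ and $s_{w(H)}=s_H$ for all $w\in W$. With $\rho_{H,j}=j/n_H$ and $(sc)_{H,j}=c_{H,s_H^{-1}(j)}$, the dot action of $G_W$ on $\mathcal{C}$ is $s\cdot c=s(c+\rho)-\rho$. For $c\in\mathcal{C}$ and $y\in\mathfrak{h}$ the Dunkl operator is $y_c=\partial_y-\sum_{H\in\mathcal{A}}\frac{\alpha_H(y)}{\alpha_H}\sum_{j=0}^{n_H-1}n_Hc_{H,j}e_{H,j}\in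 D(\mathfrak{h}^\circ)\rtimes W$. The rational Cherednik algebra $H_c$ is the subalgebra of $D(\mathfrak{h}^\circ)\rtimes W$ generated by $\mathbf{C}[\mathfrak{h}]$, $W$, and all $y_c$ for $y\in\mathfrak{h}$. $e=\frac1{|W|}\sum_{w\in W}w$ is the symmetrizing idempotent. *)

(* Defs.v *)
From HB Require Import structures.
From mathcomp Require Import all_boot all_order all_algebra all_fingroup.
From mathcomp Require Import mxrepresentation generic_quotient ring.
From mathcomp Require Import boolp classical_sets.
From mathcomp Require Import mpoly.

Set Implicit Arguments.
Unset Strict Implicit.
Unset Printing Implicit Defensive.

Import GRing.Theory.
Local Open Scope ring_scope.

Local Notation "x %:F" := (@FracField.tofrac _ x).

Fact leibniz_quotient (K : fieldType) (a b c e : K) :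
  b != 0 -> e != 0 -> forall a' b' c' e' : K,
  ((a' * c + a * c') * (b * e) - a * c * (b' * e + b * e')) / (b * e * (b * e)) =
  (a' * b - a * b') / (b * b) * (c / e) + a / b * ((c' * e - c * e') / (e * e)).
Proof. by move=> b0 e0 a' b' c' e'; field; rewrite b0 e0. Qed.

Fact add_quotient (K : fieldType) (a b c e : K) :
  b != 0 -> e != 0 -> forall a' b' c' e' : K,
  ((a' * e + a * e' + (c' * b + c * b')) * (b * e)
     - (a * e + c * b) * (b' * e + b * e')) / (b * e * (b * e)) =
  (a' * b - a * b') / (b * b) + (c' * e - c * e') / (e * e).
Proof. by move=> b0 e0 a' b' c' e'; field; rewrite b0 e0. Qed.

(* Extensions to {fraction R} of an injective ring endomorphism and of a
   derivation of R, computed on a chosen numerator and denominator; see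
   [frac_homE] and [frac_derE] for independence of that choice. *)
Section FractionExtension.
Variable R : idomainType.
Implicit Types (x : {fraction R}) (a b : R).

Definition frac_hom (phi : R -> R) x : {fraction R} :=
  (phi \n_(repr x))%:F / (phi \d_(repr x))%:F.

Definition frac_der (d : R -> R) x : {fraction R} :=
  (d \n_(repr x) * \d_(repr x) - \n_(repr x) * d \d_(repr x))%:F
    / (\d_(repr x) ^+ 2)%:F.

Lemma frac_repr x : x = (\n_(repr x))%:F / (\d_(repr x))%:F.
Proof.
rewrite -[LHS]reprK; case: (repr x) => -[a b] /= b0.
have bF0 : b%:F != 0 :> {fraction R} by rewrite tofrac_eq0.
apply: (mulIf bF0); rewrite divfK //.
unlock FracField.tofrac; rewrite -[LHS]FracField.pi_mul.
apply/eqmodP; rewrite /= FracField.equivfE /FracField.mulf /=.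
by rewrite !numden_Ratio ?(oner_neq0, mulf_neq0) //= !mulr1 mulrC.
Qed.

Lemma fracP x : exists a b, b != 0 /\ x = a%:F / b%:F.
Proof.
exists \n_(repr x), \d_(repr x).
by split; [exact: denom_ratioP | exact: frac_repr].
Qed.

Lemma frac_eq a b a' b' : b != 0 -> b' != 0 ->
  (a%:F / b%:F == a'%:F / b'%:F :> {fraction R}) = (a * b' == a' * b).
Proof.
move=> b0 b'0; rewrite eqr_div ?tofrac_eq0 //.
by rewrite -!rmorphM tofrac_eq.
Qed.

Lemma repr_frac a b : b != 0 ->
  a * \d_(repr (a%:F / b%:F)) = \n_(repr (a%:F / b%:F)) * b.
Proof.
move=> b0; apply/eqP; rewrite -frac_eq ?denom_ratioP //.
by rewrite -frac_repr.
Qed.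

Lemma frac_homE (phi : {rmorphism R -> R}) a b : injective phi -> b != 0 ->
  frac_hom phi (a%:F / b%:F) = (phi a)%:F / (phi b)%:F.
Proof.
move=> phiI b0; have phi0 c : (phi c == 0) = (c == 0).
  by rewrite -[in LHS](rmorph0 phi); exact: inj_eq.
rewrite /frac_hom; apply/eqP; rewrite frac_eq ?phi0 ?denom_ratioP //.
by rewrite -!rmorphM -repr_frac.
Qed.

Lemma frac_homM (phi : {rmorphism R -> R}) : injective phi ->
  {morph frac_hom phi : x y / x * y}.
Proof.
move=> phiI x y; have [a [b [b0 ->]]] := fracP x.
have [c [e [e0 ->]]] := fracP y.
rewrite mulf_div -!rmorphM !frac_homE ?mulf_neq0 //.
by rewrite !rmorphM mulf_div.
Qed.

Lemma frac_derE (d : R -> R) a b :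
    (forall u v, d (u * v) = d u * v + u * d v) -> b != 0 ->
  frac_der d (a%:F / b%:F) = (d a * b - a * d b)%:F / (b ^+ 2)%:F.
Proof.
move=> dM b0; rewrite /frac_der; move: (repr_frac a b0).
move: (denom_ratioP (repr (a%:F / b%:F))).
move: (\n_ _) (\d_ _) => u v v0 e.
have ed : d a * v + a * d v = d u * b + u * d b by rewrite -!dM e.
apply/eqP; rewrite frac_eq ?expf_neq0 // -subr_eq0; apply/eqP.
transitivity (b * v * ((d u * b + u * d b) - (d a * v + a * d v))
  + (a * v - u * b) * (v * d b + b * d v)); first by ring.
by rewrite -ed e !subrr mulr0 mul0r addr0.
Qed.

Lemma frac_derM (d : R -> R) x y :
    (forall u v, d (u * v) = d u * v + u * d v) ->
  frac_der d (x * y) = frac_der d x * y + x * frac_der d y.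
Proof.
move=> dM; have [a [b [b0 ->]]] := fracP x; have [c [e [e0 ->]]] := fracP y.
have bF0 : b%:F != 0 :> {fraction R} by rewrite tofrac_eq0.
have eF0 : e%:F != 0 :> {fraction R} by rewrite tofrac_eq0.
rewrite mulf_div -!rmorphM !frac_derE ?mulf_neq0 // !dM !expr2.
rewrite !(rmorphM, rmorphB, rmorphD) /=.
move: (a%:F) (b%:F) (c%:F) (e%:F) bF0 eF0 ((d a)%:F) ((d b)%:F) ((d c)%:F)
  ((d e)%:F) => {x y}.
exact: leibniz_quotient.
Qed.

Lemma frac_derD (d : R -> R) x y :
    (forall u v, d (u * v) = d u * v + u * d v) ->
    (forall u v, d (u + v) = d u + d v) ->
  frac_der d (x + y) = frac_der d x + frac_der d y.
Proof.
move=> dM dD; have [a [b [b0 ->]]] := fracP x; have [c [e [e0 ->]]] := fracP y.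
have bF0 : b%:F != 0 :> {fraction R} by rewrite tofrac_eq0.
have eF0 : e%:F != 0 :> {fraction R} by rewrite tofrac_eq0.
rewrite addf_div // -!rmorphM -rmorphD !frac_derE ?mulf_neq0 // dD !dM !expr2.
rewrite !(rmorphM, rmorphB, rmorphD) /=.
move: (a%:F) (b%:F) (c%:F) (e%:F) bF0 eF0 ((d a)%:F) ((d b)%:F) ((d c)%:F)
  ((d e)%:F) => {x y}.
exact: add_quotient.
Qed.

End FractionExtension.

Section OperatorAlgebra.
Variables (F : fieldType) (V : lmodType F).
Implicit Type B : set (V -> V).

Definition op_subalgebra B : Prop :=
  [/\ B id,
      forall S T, B S -> B T -> B (fun f => S f + T f),
      forall a T, B T -> B (fun f => a *: T f)
    & forall S T, B S -> B T -> B (S \o T)].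

Definition generated_algebra (G : set (V -> V)) : set (V -> V) :=
  smallest op_subalgebra G.

End OperatorAlgebra.

(* [W] is a finite group acting on h = 'cV_n through [rW], faithfully as soon
   as [reflection_group] holds, so that it is then a subgroup of GL(h). *)
Section ReflectionGroup.
Variables (F : fieldType) (W : finGroupType) (n : nat).
Variable rW : mx_representation F [set: W]%SET n.
Local Notation h := 'cV[F]_n.

Definition lin_act (w : W) : 'End(h) := linfun (mulmx (rW w)).

Definition reflections : {set W} :=
  [set s | (\dim (fixedSpace (lin_act s))).+1 == n]%SET.

Definition reflection_group : Prop :=
  mx_faithful rW /\ <<reflections>>%g = [set: W]%SET.

(* [mx_irreducible] is not used here: it refers to the action of the matrices
   on row vectors, which is the dual of h. *)
Definition irreducible_action : Prop :=
  (0 < n)%N /\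
  forall U : {vspace h}, (forall w, (lin_act w @: U <= U)%VS) ->
    U = 0%VS \/ U = fullv.

Definition hyperplane : Type :=
  seq_sub [seq fixedSpace (lin_act s) | s in reflections].
HB.instance Definition _ := Finite.on hyperplane.
Coercion hyperplane_vspace (H : hyperplane) : {vspace h} := ssval H.

Definition pt_stab (H : hyperplane) : {set W} :=
  [set w | (H <= fixedSpace (lin_act w))%VS]%SET.
Local Notation nH H := #|pt_stab H|.

Definition translate (w : W) (H : hyperplane) : {vspace h} := (lin_act w @: H)%VS.

(* The index types 'I_(nH H) and 'I_(nH H') of two hyperplanes in the same
   orbit are only propositionally equal, so indices are compared in nat. *)
Definition param : Type := forall H : hyperplane, 'I_(nH H) -> F.
Definition param_inv (c : param) : Prop :=
  forall w (H H' : hyperplane), H' = translate w H :> {vspace h} ->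
  forall (j : 'I_(nH H)) (j' : 'I_(nH H')), j' = j :> nat -> c H' j' = c H j.

Definition perm_family : Type := forall H : hyperplane, {perm 'I_(nH H)}.
Definition perm_family_inv (s : perm_family) : Prop :=
  forall w (H H' : hyperplane), H' = translate w H :> {vspace h} ->
  forall (j : 'I_(nH H)) (j' : 'I_(nH H')), j' = j :> nat ->
    s H' j' = s H j :> nat.

Definition rho : param := fun H j => j%:R / (nH H)%:R.
Definition perm_act (s : perm_family) (c : param) : param :=
  fun H j => c H ((s H)^-1%g j).
Definition dot_act (s : perm_family) (c : param) : param :=
  fun H j => perm_act s (fun H j => c H j + rho j) j - rho j.

Definition lform_poly (l : 'Hom(h, F^o)) : {mpoly F[n]} :=
  \sum_(i < n) (l (delta_mx i 0) : F) *: 'X_i.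

Definition poly_at (p : {mpoly F[n]}) (v : h) : F := p.@[fun i => v i 0].

(* (w p)(v) = p(w^-1 v) *)
Definition poly_act (w : W) (p : {mpoly F[n]}) : {mpoly F[n]} :=
  p \mPo [tuple \sum_(j < n) rW w^-1%g i j *: 'X_j | i < n].

Definition poly_der (y : h) (p : {mpoly F[n]}) : {mpoly F[n]} :=
  \sum_(i < n) y i 0 *: p^`M(i).

Definition in_hreg (v : h) : Prop := forall H : hyperplane, v \notin (H : {vspace h}).

(* Fractions with denominator nowhere zero on the complement of the
   hyperplanes. *)
Definition regular : {pred {fraction {mpoly F[n]}}} := fun f =>
  `[< exists p q, [/\ f = p%:F / q%:F, q != 0
                    & forall v, in_hreg v -> poly_at q v != 0] >].

Lemma regularP f : reflect
  (exists p q, [/\ f = p%:F / q%:F, q != 0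
                 & forall v, in_hreg v -> poly_at q v != 0]) (f \in regular).
Proof. exact: asboolP. Qed.

Lemma regular_poly p : p%:F \in regular.
Proof.
apply/regularP; exists p, 1; split; rewrite ?oner_neq0 ?rmorph1 ?divr1 //.
by move=> v _; rewrite /poly_at rmorph1 oner_neq0.
Qed.

Lemma regular_subring : subring_closed regular.
Proof.
split; first by rewrite -tofrac1 regular_poly.
- move=> _ _ /regularP[p [q [-> q0 hq]]] /regularP[p' [q' [-> q'0 hq']]].
  apply/regularP; exists (p * q' - p' * q), (q * q'); split.
  + rewrite -mulNr addf_div ?tofrac_eq0 // rmorphB !rmorphM /=.
    by rewrite mulNr.
  + by rewrite mulf_neq0.
  + by move=> v hv; rewrite /poly_at mevalM mulf_neq0 ?hq ?hq'.
- move=> _ _ /regularP[p [q [-> q0 hq]]] /regularP[p' [q' [-> q'0 hq']]].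
  apply/regularP; exists (p * p'), (q * q'); split.
  + by rewrite mulf_div !rmorphM.
  + by rewrite mulf_neq0.
  + by move=> v hv; rewrite /poly_at mevalM mulf_neq0 ?hq ?hq'.
Qed.

HB.instance Definition _ :=
  GRing.isSubringClosed.Build {fraction {mpoly F[n]}} regular regular_subring.

(* The coordinate ring of the complement of the hyperplanes. *)
Record regfun : Type :=
  RegFun { regfun_val : {fraction {mpoly F[n]}}; _ : regfun_val \in regular }.

HB.instance Definition _ := [isSub for regfun_val].
HB.instance Definition _ := [Choice of regfun by <:].
HB.instance Definition _ := [SubChoice_isSubComNzRing of regfun by <:].

Definition of_poly (p : {mpoly F[n]}) : regfun := RegFun (regular_poly p).

Lemma of_poly_zmod : zmod_morphism of_poly.
Proof. by move=> p q; apply: val_inj; rewrite /= rmorphB. Qed.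
Lemma of_poly_monoid : monoid_morphism of_poly.
Proof. by split=> [|p q]; apply: val_inj; rewrite /= ?rmorph1 ?rmorphM. Qed.
HB.instance Definition _ :=
  GRing.isZmodMorphism.Build {mpoly F[n]} regfun of_poly of_poly_zmod.
HB.instance Definition _ :=
  GRing.isMonoidMorphism.Build {mpoly F[n]} regfun of_poly of_poly_monoid.

Definition regfun_scale (a : F) (f : regfun) : regfun := of_poly a%:MP * f.

Lemma regfun_scaleA a b f :
  regfun_scale a (regfun_scale b f) = regfun_scale (a * b) f.
Proof. by rewrite /regfun_scale mulrA -rmorphM /= -mpolyCM. Qed.
Lemma regfun_scale1 : left_id 1 regfun_scale.
Proof. by move=> f; rewrite /regfun_scale mpolyC1 rmorph1 mul1r. Qed.
Lemma regfun_scaleDr : right_distributive regfun_scale +%R.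
Proof. by move=> a f g; rewrite /regfun_scale mulrDr. Qed.
Lemma regfun_scaleDl f : {morph regfun_scale^~ f : a b / a + b}.
Proof. by move=> a b; rewrite /regfun_scale mpolyCD rmorphD mulrDl. Qed.
HB.instance Definition _ := GRing.Zmodule_isLmodule.Build F regfun
  regfun_scaleA regfun_scale1 regfun_scaleDr regfun_scaleDl.
Lemma regfun_scaleAl (a : F) (f g : regfun) : a *: (f * g) = a *: f * g.
Proof. exact: mulrA. Qed.
HB.instance Definition _ :=
  GRing.Lmodule_isLalgebra.Build F regfun regfun_scaleAl.
HB.instance Definition _ := GRing.Lalgebra_isComAlgebra.Build F regfun.

Definition regfun_unit : {pred regfun} :=
  fun f => (val f != 0) && ((val f)^-1 \in regular).
Definition regfun_inv (f : regfun) : regfun :=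
  if regfun_unit f then insubd f (val f)^-1 else f.

Lemma regfun_mulVr : {in regfun_unit, left_inverse 1 regfun_inv *%R}.
Proof.
move=> f uf; apply: val_inj; rewrite /regfun_inv [regfun_unit f]uf.
case/andP: uf => f0 rf.
by rewrite rmorphM /= insubdK // mulVf.
Qed.
Lemma regfun_unitP (f g : regfun) : g * f = 1 -> regfun_unit f.
Proof.
move=> /(congr1 val); rewrite rmorphM rmorph1 /= => e.
have f0 : val f != 0.
  by apply: contra_eq_neq e => ->; rewrite mulr0 eq_sym oner_neq0.
rewrite /regfun_unit f0 /=; have -> : (val f)^-1 = val g.
  by apply: (mulIf f0); rewrite mulVf.
exact: valP.
Qed.
Lemma regfun_inv_out : {in [predC regfun_unit], regfun_inv =1 id}.
Proof. by move=> f /negbTE uf; rewrite /regfun_inv [regfun_unit f]uf. Qed.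
HB.instance Definition _ := GRing.ComNzRing_hasMulInverse.Build regfun
  regfun_mulVr regfun_unitP regfun_inv_out.


Lemma lin_actE w v : lin_act w v = rW w *m v.
Proof. by rewrite lfunE. Qed.

Lemma rW_mulmx w w' (v : h) : rW (w * w')%g *m v = rW w *m (rW w' *m v).
Proof. by rewrite repr_mxM ?inE // mulmxA. Qed.

Lemma rW_mulKV w (v : h) : rW w *m (rW w^-1%g *m v) = v.
Proof. by rewrite -rW_mulmx mulgV repr_mx1 mul1mx. Qed.

Lemma rW_mulK w (v : h) : rW w^-1%g *m (rW w *m v) = v.
Proof. by rewrite -rW_mulmx mulVg repr_mx1 mul1mx. Qed.

Lemma reflections_conj s w : s \in reflections -> (w * s * w^-1)%g \in reflections.
Proof.
rewrite !inE => /eqP es; apply/eqP; rewrite -[RHS]es; congr _.+1.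
have -> : fixedSpace (lin_act (w * s * w^-1)) =
          (lin_act w @: fixedSpace (lin_act s))%VS.
  apply/vspaceP => v; apply/fixedSpaceP/memv_imgP => [|[u /fixedSpaceP]].
    rewrite lin_actE -mulgA rW_mulmx rW_mulmx => e.
    exists (rW w^-1%g *m v); last by rewrite lin_actE rW_mulKV.
    by apply/fixedSpaceP; rewrite lin_actE -[in RHS]e rW_mulK.
  rewrite lin_actE => e ->.
  by rewrite !lin_actE -mulgA rW_mulmx rW_mulmx rW_mulK e.
apply: limg_dim_eq; apply/eqP; rewrite -subv0; apply/subvP => v.
rewrite memv_cap memv_ker lin_actE => /andP[_ /eqP e].
by rewrite memv0 -[v](rW_mulK w) e mulmx0.
Qed.

Lemma in_hreg_act w v : in_hreg v -> in_hreg (rW w *m v).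
Proof.
move=> hv [H hH]; apply/negP => /= vH.
have /fintype.imageP[s sR eH] := hH.
have hH' : fixedSpace (lin_act (w^-1 * s * w)) \in
    [seq fixedSpace (lin_act s) | s in reflections].
  by apply: fintype.image_f; rewrite -{2}[w]invgK reflections_conj.
have /negP[] := hv (SeqSub hH'); apply/fixedSpaceP.
rewrite lin_actE -mulgA !rW_mulmx.
by move: vH; rewrite eH => /fixedSpaceP; rewrite lin_actE => ->; rewrite rW_mulK.
Qed.

Lemma poly_at_act w p v : poly_at (poly_act w p) v = poly_at p (rW w^-1%g *m v).
Proof.
rewrite /poly_at comp_mpoly_meval; apply: meval_eq => i.
rewrite tnth_mktuple mxE raddf_sum /=; apply: eq_bigr => j _.
by rewrite mevalZ mevalXU.
Qed.

Lemma poly_actM w w' p : poly_act w (poly_act w' p) = poly_act (w * w') p.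
Proof.
rewrite /poly_act (comp_mpolyEX p) [RHS]comp_mpolyEX.
rewrite raddf_sum /=; apply: eq_bigr => m _; rewrite comp_mpolyZ; congr (_ *: _).
rewrite !comp_mpolyX rmorph_prod /=; apply: eq_bigr => i _.
rewrite rmorphXn /=; congr (_ ^+ _); rewrite !tnth_mktuple.
rewrite raddf_sum /=; under eq_bigr => j _.
  rewrite comp_mpolyZ comp_mpolyXU -tnth_nth tnth_mktuple scaler_sumr; over.
rewrite exchange_big /=; apply: eq_bigr => k _.
rewrite invMg repr_mxM ?inE // mxE scaler_suml.
by apply: eq_bigr => j _; rewrite scalerA.
Qed.

Lemma poly_act1 p : poly_act 1 p = p.
Proof.
rewrite /poly_act -[RHS]comp_mpoly_id; congr (_ \mPo _).
apply: eq_from_tnth => i; rewrite !tnth_mktuple invg1 repr_mx1.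
rewrite (bigD1 i) //= big1 ?addr0 => [|j ji]; rewrite mxE ?eqxx ?scale1r //.
by rewrite eq_sym (negbTE ji) scale0r.
Qed.

Lemma poly_act_inj w : injective (poly_act w).
Proof.
by apply: (can_inj (g := poly_act w^-1)) => p; rewrite poly_actM mulVg poly_act1.
Qed.

Lemma poly_derM y p q :
  poly_der y (p * q) = poly_der y p * q + p * poly_der y q.
Proof.
rewrite /poly_der mulr_suml mulr_sumr -big_split /=; apply: eq_bigr => i _.
by rewrite mderivM scalerDr scalerAl scalerAr.
Qed.

Lemma frac_actE w a b : b != 0 ->
  frac_hom (poly_act w) (a%:F / b%:F) = (poly_act w a)%:F / (poly_act w b)%:F.
Proof. exact: (@frac_homE _ (comp_mpoly _) a b (@poly_act_inj w)). Qed.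

Lemma regular_act w f : f \in regular -> frac_hom (poly_act w) f \in regular.
Proof.
move=> /regularP[p [q [-> q0 hq]]]; rewrite frac_actE //.
apply/regularP; exists (poly_act w p), (poly_act w q); split => //.
  by apply: contra_neq q0 => e; apply: (@poly_act_inj w); rewrite e [RHS]rmorph0.
by move=> v hv; rewrite poly_at_act hq //; apply: in_hreg_act.
Qed.

Lemma regular_der y f : f \in regular -> frac_der (poly_der y) f \in regular.
Proof.
move=> /regularP[p [q [-> q0 hq]]]; rewrite frac_derE //; last exact: poly_derM.
apply/regularP; do 2 eexists; split; [by [] | by rewrite expf_neq0 |].
by move=> v hv; rewrite /poly_at rmorphXn expf_neq0 //; apply: hq.
Qed.

Definition regfun_act (w : W) (f : regfun) : regfun := RegFun (regular_act w (valP f)).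

Definition regfun_der (y : h) (f : regfun) : regfun := RegFun (regular_der y (valP f)).

(* Grothendieck's differential operators of order < m. *)
Fixpoint diffop_lt (m : nat) (T : regfun -> regfun) : Prop :=
  if m is m'.+1 then
    linear T /\ forall f, diffop_lt m' (fun g => T (f * g) - f * T g)
  else forall g, T g = 0.

Definition diffop : set (regfun -> regfun) :=
  [set T | exists m, diffop_lt m T]%classic.

Definition diffop_cross : set (regfun -> regfun) :=
  generated_algebra (diffop `|` [set regfun_act w | w in setT])%classic.

Definition stab_idem (H : hyperplane) (j : nat) (f : regfun) : regfun :=
  (nH H)%:R^-1 *: \sum_(w in pt_stab H) (\det (rW w)) ^- j *: regfun_act w f.

Definition dunkl (alpha : hyperplane -> 'Hom(h, F^o)) (c : param) (y : h)
    (f : regfun) : regfun :=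
  regfun_der y f - \sum_(H : hyperplane)
    (alpha H y : F) *: (of_poly (lform_poly (alpha H)))^-1 *
      (\sum_(j < nH H) ((nH H)%:R * c H j) *: stab_idem H j f).

Definition cherednik alpha (c : param) : set (regfun -> regfun) :=
  generated_algebra
    ([set (fun f => of_poly p * f) | p in setT]
     `|` [set regfun_act w | w in setT]
     `|` [set dunkl alpha c y | y in setT])%classic.

Definition symmetrizer (f : regfun) : regfun :=
  #|W|%:R^-1 *: \sum_(w : W) regfun_act w f.

Definition spherical alpha (c : param) : set (regfun -> regfun) :=
  [set symmetrizer \o T \o symmetrizer | T in cherednik alpha c]%classic.


Lemma generated_algebraP (V : lmodType F) (G : set (V -> V)) :
  op_subalgebra (generated_algebra G).
Proof.
split=> [B [[]] //|S T hS hT B hB|a T hT B hB|S T hS hT B hB];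
  have [[? D Z C] ?] := hB.
- by apply: D; [exact: hS|exact: hT].
- by apply: Z; exact: hT.
- by apply: C; [exact: hS|exact: hT].
Qed.

Lemma generated_algebra_gen (V : lmodType F) (G : set (V -> V)) T :
  G T -> generated_algebra G T.
Proof. by move=> GT B [_]; apply. Qed.

Lemma op_subalgebra_sum (V : lmodType F) (B : set (V -> V)) (I : Type)
    (r : seq I) (P : pred I) (T : I -> V -> V) :
  op_subalgebra B -> (forall i, P i -> B (T i)) ->
  B (fun f => \sum_(i <- r | P i) T i f).
Proof.
move=> [B1 BD BZ _] BT; elim: r => [|i r IHr].
  have := BZ 0 _ B1; congr B; apply: funext => f.
  by rewrite big_nil scale0r.
case Pi: (P i); last first.
  by move: IHr; congr B; apply: funext => f; rewrite big_cons Pi.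
have := BD _ _ (BT i Pi) IHr; congr B; apply: funext => f.
by rewrite big_cons Pi.
Qed.

Lemma regfun_valD (f g : regfun) : val (f + g) = val f + val g.
Proof. exact: (rmorphD val). Qed.

Lemma regfun_valM (f g : regfun) : val (f * g) = val f * val g.
Proof. exact: (rmorphM val). Qed.

Lemma regfun_val_act w (f : regfun) :
  val (regfun_act w f) = frac_hom (poly_act w) (val f).
Proof. by []. Qed.

Lemma regfun_val_der y (f : regfun) :
  val (regfun_der y f) = frac_der (poly_der y) (val f).
Proof. by []. Qed.

Lemma regfun_derM y f g :
  regfun_der y (f * g) = regfun_der y f * g + f * regfun_der y g.
Proof.
apply: val_inj; rewrite regfun_valD !regfun_valM !regfun_val_der regfun_valM.
by rewrite frac_derM //; exact: poly_derM.
Qed.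

Lemma poly_der_linear y : linear (poly_der y).
Proof.
move=> a p q; rewrite /poly_der scaler_sumr -big_split /=.
apply: eq_bigr => i _.
by rewrite mderivD mderivZ scalerDr !scalerA [a * _]mulrC.
Qed.

Lemma regfun_derD y f g : regfun_der y (f + g) = regfun_der y f + regfun_der y g.
Proof.
apply: val_inj; rewrite regfun_valD !regfun_val_der regfun_valD.
rewrite frac_derD //; first exact: poly_derM.
by move=> p q; have := poly_der_linear y 1 p q; rewrite !scale1r.
Qed.

Lemma regfun_derC y a : regfun_der y (of_poly a%:MP) = 0.
Proof.
apply: val_inj; rewrite /= -[X in frac_der _ X]divr1 -tofrac1.
rewrite frac_derE ?oner_neq0 //; last exact: poly_derM.
have dC b : poly_der y b%:MP = 0.
  by rewrite /poly_der big1 // => i _; rewrite mderivC scaler0.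
by rewrite -mpolyC1 !dC mul0r mulr0 subrr rmorph0 mul0r.
Qed.

Lemma regfun_der_linear y : linear (regfun_der y).
Proof.
move=> a f g; rewrite regfun_derD; congr (_ + _).
by rewrite [a *: f]/(of_poly a%:MP * f) regfun_derM regfun_derC mul0r add0r.
Qed.

Lemma regfun_mul_diffop f : diffop (fun g => f * g).
Proof.
exists 1%N; split=> [a g k|g k] /=; first by rewrite mulrDr scalerAr.
by rewrite mulrCA subrr.
Qed.

Lemma regfun_der_diffop y : diffop (regfun_der y).
Proof.
exists 2%N; split=> [|f]; first exact: regfun_der_linear.
split=> [a g k|g k] /=; rewrite !regfun_derM ?addrK.
  by rewrite mulrDr scalerAr.
by rewrite mulrCA subrr.
Qed.

Lemma dunkl_cross alpha c y : diffop_cross (dunkl alpha c y).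
Proof.
have A := generated_algebraP (diffop `|` [set regfun_act w | w in setT])%classic.
have [_ AD AZ AC] := A; pose B := diffop_cross.
have Bact w : B (regfun_act w) by apply: generated_algebra_gen; right; exists w.
have Bmul f : B (fun g => f * g).
  by apply: generated_algebra_gen; left; exact: regfun_mul_diffop.
have Bder : B (regfun_der y).
  by apply: generated_algebra_gen; left; exact: regfun_der_diffop.
have Bidem H j : B (stab_idem H j).
  apply: (AZ _ (fun f => \sum_(w in pt_stab H) _)).
  by apply: op_subalgebra_sum => // w _; exact: AZ (Bact w).
have Bsum : B (fun f => \sum_(H : hyperplane)
    (alpha H y : F) *: (of_poly (lform_poly (alpha H)))^-1 *
      (\sum_(j < nH H) ((nH H)%:R * c H j) *: stab_idem H j f)).
  apply: op_subalgebra_sum => // H _; apply: AC (Bmul _) _.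
  by apply: op_subalgebra_sum => // j _; exact: AZ (Bidem H j).
have := AD _ _ Bder (AZ (-1) _ Bsum).
by congr generated_algebra; apply: funext => f; rewrite scaleN1r.
Qed.

Lemma cherednik_cross alpha c : (cherednik alpha c `<=` diffop_cross)%classic.
Proof.
move=> T; apply; split; first exact: generated_algebraP.
move=> S [[[p _ <-]|[w _ <-]]|[y _ <-]]; last exact: dunkl_cross.
  by apply: generated_algebra_gen; left; exact: regfun_mul_diffop.
by apply: generated_algebra_gen; right; exists w.
Qed.

Lemma spherical_cross alpha c : (spherical alpha c `<=` diffop_cross)%classic.
Proof.
have A := generated_algebraP (diffop `|` [set regfun_act w | w in setT])%classic.
have [_ _ AZ AC] := A; have sym_in : diffop_cross symmetrizer.
  apply: (AZ _ (fun f => \sum_(w : W) _)); apply: op_subalgebra_sum => // w _.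
  by apply: generated_algebra_gen; right; exists w.
move=> _ [T hT <-]; exact: (AC _ _ (AC _ _ sym_in (cherednik_cross hT)) sym_in).
Qed.

Lemma poly_at_lform l v : poly_at (lform_poly l) v = l v.
Proof.
rewrite /poly_at /lform_poly raddf_sum /=.
rewrite [in RHS](matrix_sum_delta v) linear_sum /=; apply: eq_bigr => i _.
by rewrite big_ord1 [in RHS]linearZ mevalZ mevalXU; exact: mulrC.
Qed.

Lemma lform_poly_unit (H : hyperplane) l : lker l = H ->
  of_poly (lform_poly l) \is a GRing.unit.
Proof.
move=> kerl; apply/andP.
suff p0 : lform_poly l != 0.
  split; first by rewrite tofrac_eq0.
  apply/regularP; exists 1, (lform_poly l); split=> //.
    by rewrite rmorph1 div1r.
  move=> v /(_ H); rewrite -kerl memv_ker => lv.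
  by rewrite poly_at_lform; exact: lv.
apply/eqP => l0; have : H = fullv :> {vspace h}.
  rewrite -kerl; apply/vspaceP => v; rewrite memvf memv_ker.
  by apply/eqP; rewrite -poly_at_lform l0 /poly_at rmorph0.
have /fintype.imageP[s sR eH] := ssvalP H.
move: sR; rewrite inE => /eqP es eHf.
have := es; rewrite -eH [ssval H]eHf dimvf /dim /= muln1.
by move/eqP; rewrite gtn_eqF.
Qed.

Lemma regfun_actM w f g :
  regfun_act w (f * g) = regfun_act w f * regfun_act w g.
Proof.
apply: val_inj; rewrite regfun_valM !regfun_val_act regfun_valM.
exact: (@frac_homM _ (comp_mpoly _) (@poly_act_inj w)).
Qed.

End ReflectionGroup.

(* Main.v *)
Require Import Defs.
From HB Require Import structures.
From mathcomp Require Import all_boot all_order all_algebra all_fingroup.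
From mathcomp Require Import cyclic mxrepresentation ring boolp classical_sets.
From mathcomp Require Import reals complex ssrcomplements mpoly.

Set Implicit Arguments.
Unset Strict Implicit.
Unset Printing Implicit Defensive.

Import Order.TTheory GRing.Theory Num.Theory.
Local Open Scope ring_scope.

(** The theorem is a statement about generic points of the reflecting
hyperplanes. On [W]-invariant functions an element of the algebra of operators
acts as a differential operator, hence is determined by its full symbol, a
polynomial in [n] variables over the ring of regular functions; [Op] turns a
symbol into an operator. The spherical subalgebra of parameter [c] consists of
the operators [Op P e] where [P] is an invariant symbol subject to one condition
for each hyperplane [H] ([sphericalP]), and this condition turns out to depend
only on the orbit of [c] under the dot action.

To find the condition at [H], let the operators act on [alpha ^ t] times an
exponential of the coordinates of [H], where [t] is an indeterminate. The result
is the twisted symbol ([twisted]), a polynomial in [t]. Up to terms of higher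
order along [H], the Dunkl operator in the direction transverse to [H] sends
[alpha ^ (t - k)] to the multiple [t - mu k] of [alpha ^ (t - k - 1)], where
[mu k = k + n_H c_(H, k mod n_H)] ([exponentE]). The twisted symbols of the
elements of the Cherednik algebra therefore lie in the lattice generated, over
the functions without a pole along [H], by the products of [alpha ^- k] with
[(t - mu 0) ... (t - mu (k - 1))] ([lattice], [dunkl_lattice],
[lattice_sym_dunkl]).

Conversely, let the twisted symbols of an invariant symbol [P] lie in all these
lattices. The lattices force the top coefficients of [P] to have no pole along
any hyperplane ([twisted_top]), hence to be polynomials ([no_pole_all_poly]). A
combination of products of Dunkl operators has the same top coefficients, and
subtracting its average over [W] from [P] lowers the order: an induction
realizes [P] by an element of the Cherednik algebra ([lattice_sym_realized]).

Finally, the twisted symbol of an invariant symbol is invariant under the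
pointwise stabilizer of [H], and the invariants of the lattice only involve the
generators with [k] a multiple [q * n_H] of the order of this stabilizer
([lattice_inv_change]). For such [k] the product of the [t - mu i] is
[\prod_(i < q) \prod_(j < n_H) (t - n_H i - n_H (c_(H, j) + j / n_H))], which is
symmetric in the numbers [c_(H, j) + j / n_H] that the dot action permutes
([newton_exponent_dot_act]). *)

(** * Multivariate polynomials *)

Section MPolyGeneralities.
Variables (n : nat) (R : comNzRingType).
Implicit Types p q : {mpoly R[n]}.

Lemma msize_leP p d :
  reflect (forall m, (d <= mdeg m)%N -> p@_m = 0) (msize p <= d)%N.
Proof.
apply: (iffP idP) => [le_pd m dm|h].
  by apply: memN_msupp_eq0; apply: msize_mdeg_ge; exact: leq_trans dm.
rewrite msizeE; apply/bigmax_leqP_seq => m; rewrite mcoeff_msupp => pm _.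
by rewrite ltnNge; apply: contra pm => /h ->.
Qed.

Lemma msizeD_leq p q d :
  (msize p <= d)%N -> (msize q <= d)%N -> (msize (p + q) <= d)%N.
Proof. by move=> pd qd; apply: leq_trans (msizeD_le _ _) _; rewrite geq_max pd. Qed.

Lemma msizeM_leq p q a b :
  (msize p <= a)%N -> (msize q <= b.+1)%N -> (msize (p * q) <= a + b)%N.
Proof.
move=> /msize_leP pa /msize_leP qb; apply/msize_leP => m abm.
rewrite mcoeffM big1 // => -[k1 k2] /= /eqP em.
have [/pa->|k1a] := leqP a (mdeg k1); first by rewrite mul0r.
rewrite qb ?mulr0 // ltnNge; apply/negP => k2b.
by move: abm; rewrite em mdegD leqNgt -addSn leq_add.
Qed.

Lemma mnm_ind (P : 'X_{1..n} -> Prop) :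
  P 0%MM -> (forall m i, P m -> P (m + U_(i))%MM) -> forall m, P m.
Proof.
move=> P0 PS m; have [d] := ubnP (mdeg m); elim: d => // d IHd in m *.
rewrite ltnS => le_md; have [->//|m0] := eqVneq m 0%MM.
have [i mi] : exists i, m i != 0%N.
  apply/existsP; apply: contraNT m0 => /existsPn m0; apply/eqP/mnmP => i.
  by rewrite mnm0E; apply/eqP; rewrite -[_ == _]negbK m0.
have em : m = (m - U_(i) + U_(i))%MM by rewrite submK // lep1mP.
rewrite em; apply: PS; apply: IHd; apply: leq_trans le_md.
by rewrite [in X in (_ < X)%N]em mdegD mdeg1 addn1.
Qed.

Lemma mderivXU i j : ('X_j)^`M(i) = (j == i)%:R :> {mpoly R[n]}.
Proof.
rewrite mderivX mnm1E; case: eqP => [->|_]; last by rewrite scale0r.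
by rewrite scale1r -[X in (X - _)%MM]add0m addmK mpolyX0.
Qed.

Lemma mpoly_ind_mul (P : {mpoly R[n]} -> Prop) :
    (forall p q, P p -> P q -> P (p + q)) -> (forall c, P c%:MP) ->
    (forall p i, P p -> P (p * 'X_i)) -> forall p, P p.
Proof.
move=> PD PC PX; have PM c m : P (c *: 'X_[m]).
  rewrite -[c *: _]mul_mpolyC; elim/mnm_ind: m => [|m i IHm].
    by rewrite mpolyX0 mulr1.
  by rewrite mpolyXD mulrA; exact: PX.
by elim/mpolyind => [|c m p _ _ Pp]; [rewrite -mpolyC0; exact: PC|exact: PD].
Qed.

Lemma mpoly_rmorph_eq (S : nzRingType) (f g : {rmorphism {mpoly R[n]} -> S}) :
  (forall c, f c%:MP = g c%:MP) -> (forall i, f 'X_i = g 'X_i) -> f =1 g.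
Proof.
move=> eC eX; elim/mpoly_ind_mul => // [p q ep eq|p i ep].
  by rewrite !rmorphD /= ep eq.
by rewrite !rmorphM /= ep eX.
Qed.

End MPolyGeneralities.

Section LineRestriction.
Variables (F : numClosedFieldType) (n : nat).
Implicit Types (p q : {mpoly F[n]}) (v y : 'I_n -> F).

Definition on_line v y : {mpoly F[n]} -> {poly F} :=
  mmap polyC (fun i => (v i)%:P + y i *: 'X).
HB.instance Definition _ v y := GRing.RMorphism.copy (on_line v y) (on_line v y).

Lemma horner_on_line v y p a :
  (on_line v y p).[a] = p.@[fun i => v i + y i * a].
Proof.
elim/mpoly_ind_mul: p => [p q ep eq|c|p i ep].
- by rewrite rmorphD /= hornerD ep eq mevalD.
- by rewrite /on_line mmapC hornerC mevalC.
by rewrite rmorphM /= hornerM ep mevalM mevalXU /on_line mmapX mmap1U !hornerE.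
Qed.

Lemma deriv_on_line v y p :
  (on_line v y p)^`().[0] = \sum_i y i * (p^`M(i)).@[v].
Proof.
have e0 q : (on_line v y q).[0] = q.@[v].
  by rewrite horner_on_line; apply: meval_eq => i; rewrite mulr0 addr0.
elim/mpoly_ind_mul: p => [p q ep eq|c|p j ep].
- rewrite rmorphD /= derivD hornerD ep eq -big_split; apply: eq_bigr => i _.
  by rewrite mderivD mevalD mulrDr.
- rewrite /on_line mmapC derivC horner0 big1 // => i _.
  by rewrite mderivC meval0 mulr0.
rewrite rmorphM /= derivM hornerD !hornerM ep !e0.
have -> : on_line v y 'X_j = (v j)%:P + y j *: 'X by rewrite /on_line mmapX mmap1U.
rewrite derivD derivC derivZ derivX !hornerE.
under [RHS]eq_bigr => i _ do rewrite mderivM mevalD !mevalM mevalXU mulrDr.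
rewrite big_split /= mulr_suml; congr (_ + _).
  by apply: eq_bigr => i _; rewrite mevalXU mulrA.
rewrite (bigD1 j) //= big1 ?addr0 => [|i ij].
  by rewrite mderivXU eqxx meval1 !mulr1 mulrC.
by rewrite mderivXU eq_sym (negbTE ij) meval0 !mulr0.
Qed.

Lemma mderiv_eq0_const p : (forall i, p^`M(i) = 0) -> p = (p@_0)%:MP.
Proof.
move=> dp; apply/mpolyP => m; rewrite mcoeffC.
have [<-|m0] := eqVneq 0%MM m; first by rewrite mulr1.
rewrite mulr0.
have [i [m' em]] : exists i m', m = (m' + U_(i))%MM.
  by elim/mnm_ind: m m0 => [|m' i _ _]; [rewrite eqxx|exists i, m'].
have /eqP := congr1 (mcoeff m') (dp i).
rewrite mcoeff0 mcoeff_mderiv -em -mulr_natr mulf_eq0 pnatr_eq0 orbF.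
by move/eqP.
Qed.

Lemma poly_nat_nz (p : {poly F}) : p != 0 -> exists a, p.[a] != 0.
Proof.
move=> p0; apply: contrapT => /forallNP h.
have := @max_poly_roots _ p [seq i%:R | i <- iota 0 (size p)] p0.
rewrite size_map size_iota ltnn => /(_ _ _)/negP; apply => //.
  by apply/allP => a _; rewrite /root; apply/negPn/negP; exact: h.
by rewrite map_inj_uniq ?iota_uniq // => i j /eqP; rewrite eqr_nat => /eqP.
Qed.

(** By induction on the degree: if [p] vanishes at every point, then so do its
restrictions to lines, hence all its derivatives; so [p] is constant. *)
Lemma mpoly_nz_eval p : p != 0 -> exists v, p.@[v] != 0.
Proof.
have [d] := ubnP (msize p); elim: d => // d IHd in p *; rewrite ltnS => le_pd.
apply: contra_neqP => /forallNP p0.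
have pv v : p.@[v] = 0 by apply/eqP/negPn/negP; exact: p0.
have dp i : p^`M(i) = 0.
  apply/eqP; apply: contrapT => /negP dp0.
  have [|v dv] := IHd p^`M(i) _ dp0.
    case: (d) le_pd => [|k].
      rewrite leqn0 msize_poly_eq0 => /eqP p_0.
      by rewrite p_0 mderiv0 eqxx in dp0.
    move=> /msize_leP pk; rewrite ltnS; apply/msize_leP => m km.
    by rewrite mcoeff_mderiv pk ?mul0rn // mdegD mdeg1 addn1.
  have := deriv_on_line v (fun j => (j == i)%:R) p.
  have -> : on_line v (fun j => (j == i)%:R) p = 0.
    apply: contraTeq isT => /poly_nat_nz[a].
    by rewrite horner_on_line pv eqxx.
  rewrite deriv0 horner0 (bigD1 i) //= eqxx mul1r big1 ?addr0.
    by move=> e; rewrite -e eqxx in dv.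
  by move=> j /negbTE->; rewrite mul0r.
have := mderiv_eq0_const dp => ep; rewrite ep.
by have := pv (fun=> 0); rewrite ep mevalC mcoeffC eqxx mulr1 => ->.
Qed.

End LineRestriction.

(** * Polynomials vanishing on hyperplanes *)

Section LinearForms.
Variables (F : numClosedFieldType) (n : nat).
Local Notation h := 'cV[F]_n.
Implicit Types (l : 'Hom(h, F^o)) (p q : {mpoly F[n]}) (v y : h).

Lemma poly_at_nz p : p != 0 -> exists v, poly_at p v != 0.
Proof.
move=> /mpoly_nz_eval[v pv]; exists (\col_i v i); apply: contra pv => /eqP e.
by rewrite -[X in _ == X]e; apply/eqP/meval_eq => i; rewrite mxE.
Qed.

Lemma poly_at_eq p q : (forall v, poly_at p v = poly_at q v) -> p = q.
Proof.
move=> e; apply/eqP; rewrite -subr_eq0; apply: contrapT => /negP /poly_at_nz[v].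
by rewrite /poly_at mevalB -/(poly_at p v) e subrr eqxx.
Qed.

Lemma lform_polyZ a l : lform_poly (a *: l) = a *: lform_poly l.
Proof.
rewrite /lform_poly scaler_sumr; apply: eq_bigr => i _.
by rewrite scalerA scale_lfunE.
Qed.

(** When [l y = 1], the pullback along the projection to the kernel of [l] parallel
to [y], that is, restriction to this kernel. *)
Definition proj_poly l y : {mpoly F[n]} -> {mpoly F[n]} :=
  comp_mpoly [tuple 'X_i - y i 0 *: lform_poly l | i < n].
HB.instance Definition _ l y :=
  GRing.RMorphism.copy (proj_poly l y) (proj_poly l y).

Lemma poly_at_proj l y p v : poly_at (proj_poly l y p) v = poly_at p (v - l v *: y).
Proof.
rewrite /poly_at comp_mpoly_meval; apply: meval_eq => i.
rewrite tnth_mktuple mevalB mevalXU mevalZ -/(poly_at _ v) poly_at_lform !mxE.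
by rewrite mulrC.
Qed.

Lemma proj_polyX l y i : proj_poly l y 'X_i = 'X_i - y i 0 *: lform_poly l.
Proof. by rewrite /proj_poly comp_mpolyXU -tnth_nth tnth_mktuple. Qed.

Lemma proj_polyC l y c : proj_poly l y c%:MP = c%:MP.
Proof. exact: comp_mpolyC. Qed.

Lemma sub_proj_poly l y p : exists q, p - proj_poly l y p = lform_poly l * q.
Proof.
elim/mpoly_ind_mul: p => [p p' [q e] [q' e']|c|p i [q e]].
- by exists (q + q'); rewrite rmorphD /= mulrDr -e -e' opprD addrACA.
- by exists 0; rewrite proj_polyC subrr mulr0.
exists (q * 'X_i + y i 0 *: proj_poly l y p).
rewrite rmorphM /= proj_polyX -!mul_mpolyC.
move/eqP: e; rewrite subr_eq => /eqP e; rewrite [X in X * 'X_i - _]e.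
by ring.
Qed.

Lemma proj_lform l y : l y = 1 -> proj_poly l y (lform_poly l) = 0.
Proof.
move=> ly; apply: poly_at_eq => v; rewrite poly_at_proj poly_at_lform.
rewrite linearB linearZ /= ly /poly_at meval0.
by rewrite [_ *: _]mulr1 subrr.
Qed.

Lemma proj_poly_eq0 l y p : l y = 1 ->
  proj_poly l y p = 0 <-> exists q, p = lform_poly l * q.
Proof.
move=> ly; split=> [p0|[q ->]]; last by rewrite rmorphM /= proj_lform ?mul0r.
by have [q e] := sub_proj_poly l y p; exists q; rewrite -e p0 subr0.
Qed.

(** An elementary substitute for the Nullstellensatz. On a generic line, of direction
[y], a nonconstant [q] has a root, which has to lie on one of the hyperplanes; so
the product over the hyperplanes of the pullbacks of [q] along the projections
parallel to [y] vanishes, and one of the factors does. *)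
Lemma lform_dvd_of_nonvanishing (I : finType) (L : I -> 'Hom(h, F^o)) q :
    (forall i, lform_poly (L i) != 0) ->
    (forall v, (forall i, L i v != 0) -> poly_at q v != 0) ->
    (1 < msize q)%N ->
  exists i q', q = lform_poly (L i) * q'.
Proof.
move=> L0 qv q1.
have [i0 dq0]: exists i, q^`M(i) != 0.
  apply: contrapT => /forallNP h; move: q1.
  rewrite (_ : q = (q@_0)%:MP) ?msizeC ?ltnNge ?leq_b1 //.
  by apply: mderiv_eq0_const => i; apply/eqP; apply: contrapT => /negP; exact: h.
have [v0 dqv0] := poly_at_nz dq0.
(* The direction y is parallel to no hyperplane, and q has a nonzero derivative
   along y. *)
pose dq := \sum_j poly_at q^`M(j) v0 *: 'X_j : {mpoly F[n]}.
have dqE y : poly_at dq y = \sum_j y j 0 * poly_at q^`M(j) v0.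
  rewrite /poly_at /dq raddf_sum /=; apply: eq_bigr => j _.
  by rewrite mevalZ mevalXU mulrC.
have /poly_at_nz[y] : (\prod_i lform_poly (L i)) * dq != 0.
  rewrite mulf_neq0 //; first by apply/prodf_neq0 => i _.
  apply: contra_neq dqv0 => dq_0; have := dqE (delta_mx i0 0).
  rewrite dq_0 {1}/poly_at meval0 (bigD1 i0) //= big1 => [|j ij].
    by rewrite mxE !eqxx mul1r addr0.
  by rewrite mxE (negbTE ij) mul0r.
rewrite /poly_at mevalM -!/(poly_at _ y) mulf_eq0 negb_or => /andP[Ly].
rewrite dqE => dqy.
have {}Ly i : L i y != 0.
  move: Ly; rewrite /poly_at rmorph_prod /= => /prodf_neq0/(_ i isT).
  by rewrite -/(poly_at _ y) poly_at_lform.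
pose l i := (L i y)^-1 *: L i.
have ly i : l i y = 1 by rewrite scale_lfunE; exact: mulVf.
apply: contrapT => ndvd.
have pq0 i : proj_poly (l i) y q != 0.
  apply/eqP => /(proj_poly_eq0 _ (ly i))[q' e]; apply: ndvd.
  by exists i, ((L i y)^-1 *: q'); rewrite e lform_polyZ -scalerAl -scalerAr.
(* Off the zeros of this product q is not constant on the line through v, and
   its roots on the line miss all the hyperplanes. *)
have dyq : poly_der y q != 0.
  apply: contra_neq dqy => /(congr1 (fun p => poly_at p v0)).
  rewrite /poly_der /poly_at meval0 raddf_sum /= => e; rewrite -[RHS]e.
  by apply: eq_bigr => j _; rewrite mevalZ.
have /poly_at_nz[v] : (\prod_i proj_poly (l i) y q) * poly_der y q != 0.
  by rewrite mulf_neq0 //; apply/prodf_neq0 => i _.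
rewrite /poly_at mevalM -!/(poly_at _ v) mulf_eq0 negb_or => /andP[pqv dyqv].
have {}pqv i : poly_at q (v - l i v *: y) != 0.
  rewrite -poly_at_proj.
  by move: pqv; rewrite /poly_at rmorph_prod /= => /prodf_neq0/(_ i isT).
pose r := on_line (fun i => v i 0) (fun i => y i 0) q.
have rE a : r.[a] = poly_at q (v + a *: y).
  by rewrite horner_on_line; apply: meval_eq => i; rewrite !mxE mulrC.
have /closed_rootP[a /eqP ra] : size r != 1%N.
  apply: contra dyqv => /eqP/eq_leq/size1_polyC e.
  have := deriv_on_line (fun i => v i 0) (fun i => y i 0) q.
  rewrite -/r e derivC horner0 => e0.
  rewrite /poly_der /poly_at raddf_sum /= [X in X == 0](_ : _ = 0) // [RHS]e0.
  by apply: eq_bigr => j _; rewrite mevalZ.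
have [i Lia]: exists i, L i (v + a *: y) = 0.
  apply: contrapT => /forallNP hL; have := qv (v + a *: y).
  rewrite -rE ra eqxx => /(_ _)/negP; apply=> // i; apply/eqP; exact: hL.
have := pqv i; suff -> : v - l i v *: y = v + a *: y by rewrite -rE ra eqxx.
congr (_ + _); rewrite -scaleNr; congr (_ *: _).
move: Lia; rewrite linearD linearZ /= => /eqP; rewrite addr_eq0 => /eqP Lv.
rewrite /l scale_lfunE Lv scalerN opprK /=.
by rewrite [_ *: _]mulrC [_ *: _]/(_ * _) mulfK.
Qed.

End LinearForms.

(** * Hyperplanes and their pointwise stabilizers *)

Lemma det_rank1_perturbation (R : comNzRingType) n (u : 'cV[R]_n) (a : 'rV[R]_n) :
  \det (1%:M + u *m a) = 1 + (a *m u) 0 0.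
Proof.
pose L : 'M_(n + 1) := block_mx 1%:M 0 a 1%:M.
pose M : 'M_(n + 1) := block_mx (1%:M + u *m a) u 0 1%:M.
pose L' : 'M_(n + 1) := block_mx 1%:M 0 (- a) 1%:M.
pose M' : 'M_(n + 1) := block_mx 1%:M u 0 (1 + (a *m u) 0 0)%:M.
have e : L *m M *m L' = M'.
  rewrite !mulmx_block !(mul1mx, mulmx1, mul0mx, mulmx0, addr0, add0r).
  rewrite /M' mulmxN addrK mulmxDr mulmx1 mulmxDl mul1mx; congr block_mx.
    by rewrite mulmxN mulmxA addrC addrA subrK addNr.
  by rewrite addrC [a *m u]mx11_scalar raddfD /= [in RHS]mxE eqxx mulr1n.
have := congr1 determinant e.
rewrite !det_mulmx !det_lblock !det_ublock !det1 !(mul1r, mulr1) => ->.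
by rewrite det_scalar1.
Qed.

Section HyperplaneGeometry.
Variables (F : numClosedFieldType) (W : finGroupType) (n : nat).
Variable rW : mx_representation F [set: W]%SET n.
Hypothesis faithful : mx_faithful rW.
Variable alpha : hyperplane rW -> 'Hom('cV[F]_n, F^o).
Hypothesis ker_alpha : forall H : hyperplane rW, lker (alpha H) = H.
Local Notation h := 'cV[F]_n.
Local Notation nH H := #|pt_stab H|.
Implicit Types (H : hyperplane rW) (v y : h) (z w : W).

Definition wdet w : F := \det (rW w).

Lemma wdetM w w' : wdet (w * w')%g = wdet w * wdet w'.
Proof. by rewrite /wdet repr_mxM ?inE // det_mulmx. Qed.

Lemma wdet1 : wdet 1 = 1.
Proof. by rewrite /wdet repr_mx1 det1. Qed.

Lemma wdet_neq0 w : wdet w != 0.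
Proof.
have := wdetM w w^-1; rewrite mulgV wdet1 => e.
by apply/eqP => w0; move/eqP: e; rewrite w0 mul0r oner_eq0.
Qed.

Lemma wdetV w : wdet w^-1 = (wdet w)^-1.
Proof.
by apply: (mulIf (wdet_neq0 w)); rewrite -wdetM mulVg wdet1 mulVf ?wdet_neq0.
Qed.

Lemma wdetJ z w : wdet (z ^ w) = wdet z.
Proof. by rewrite conjgE !wdetM wdetV mulrCA mulVf ?mulr1 ?wdet_neq0. Qed.

Lemma alphaP H a u v : alpha H (a *: u + v) = a * alpha H u + alpha H v :> F.
Proof. by rewrite linearD linearZ. Qed.

Lemma mem_hyperplane H v : (v \in (H : {vspace h})) = (alpha H v == 0).
Proof. by rewrite -ker_alpha memv_ker. Qed.

Lemma pt_stabP H z :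
  reflect (forall v, alpha H v = 0 -> rW z *m v = v) (z \in pt_stab H).
Proof.
rewrite inE; apply: (iffP subvP) => hz v.
  by move=> /eqP; rewrite -mem_hyperplane => /hz/fixedSpaceP; rewrite lin_actE.
by rewrite mem_hyperplane => /eqP/hz e; apply/fixedSpaceP; rewrite lin_actE.
Qed.

Lemma group_set_pt_stab H : group_set (pt_stab H).
Proof.
have stabP z : reflect {in (H : {vspace h}), forall v, rW z *m v = v} (z \in pt_stab H).
  rewrite inE; apply: (iffP fixedSpacesP) => hz v vH; last by rewrite lin_actE hz.
  by have := hz v vH; rewrite lin_actE.
apply/group_setP; split=> [|z w /stabP hz /stabP hw]; apply/stabP => v vH.
  by rewrite repr_mx1 mul1mx.
by rewrite rW_mulmx hw // hz.
Qed.
Canonical pt_stab_group H := Group (group_set_pt_stab H).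

Lemma hyperplane_reflection H :
  exists2 s, s \in reflections rW & H = fixedSpace (lin_act rW s) :> {vspace h}.
Proof. by have /fintype.imageP[s] := ssvalP H; exists s. Qed.

Lemma dim_hyperplane H : (\dim (H : {vspace h})).+1 = n.
Proof. by have [s + ->] := hyperplane_reflection H; rewrite inE => /eqP. Qed.

Lemma alpha_normal_exists H : exists v, alpha H v = 1.
Proof.
have [v alphaV]: exists v, alpha H v != 0.
  apply: contrapT => /forallNP h0; have := dim_hyperplane H.
  suff -> : (H : {vspace h}) = fullv.
    by rewrite dimvf /dim /= muln1 => /eqP; rewrite gtn_eqF.
  apply/vspaceP => v; rewrite memvf mem_hyperplane.
  by apply/negPn/negP; exact: h0.
by exists ((alpha H v)^-1 *: v); rewrite linearZ /=; exact: mulVf.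
Qed.

(** The average of the stabilizer of [H] is a projection onto [H] that commutes with
the stabilizer. Its kernel is a line that the stabilizer preserves. *)
Lemma coroot_exists H : exists y, alpha H y = 1 /\
  forall z, z \in pt_stab H -> exists a, rW z *m y = a *: y.
Proof.
have [v alphaV] := alpha_normal_exists H.
pose avg u : h := (nH H)%:R^-1 *: \sum_(z in pt_stab H) rW z *m u.
have nH0 : (nH H)%:R != 0 :> F by rewrite pnatr_eq0 -lt0n cardG_gt0.
have avg_id u : alpha H u = 0 -> avg u = u.
  move=> au; rewrite /avg (eq_bigr (fun=> u)) => [|z /pt_stabP]; last exact.
  by rewrite sumr_const -scaler_nat scalerA mulVf ?scale1r.
have avgM z u : z \in pt_stab H -> avg (rW z *m u) = avg u.
  move=> zH; rewrite /avg [in RHS](reindex_inj (mulIg z)) /=; congr (_ *: _).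
  apply: eq_big => [w|w _]; first by rewrite groupMr.
  by rewrite rW_mulmx.
have Mavg z u : z \in pt_stab H -> rW z *m avg u = avg u.
  move=> zH; rewrite /avg [in RHS](reindex_inj (mulgI z)) /= -scalemxAr mulmx_sumr.
  congr (_ *: _); apply: eq_big => [w|w _]; first by rewrite groupMl.
  by rewrite rW_mulmx.
have a_avg u : alpha H (avg u) = 0.
  have [s sR eH] := hyperplane_reflection H; apply/eqP; rewrite -mem_hyperplane.
  rewrite eH; apply/fixedSpaceP; rewrite lin_actE Mavg //; apply/pt_stabP => w.
  by move=> /eqP; rewrite -mem_hyperplane eH => /fixedSpaceP; rewrite lin_actE.
have avgB u u' : avg (u - u') = avg u - avg u'.
  rewrite /avg -scalerBr -sumrB; congr (_ *: _); apply: eq_bigr => z _.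
  by rewrite mulmxBr.
have avgE u : avg u = u - alpha H u *: (v - avg v).
  rewrite -[RHS]avg_id => [|]; last first.
    by rewrite linearB linearZ linearB /= alphaV a_avg subr0 [_ *: _]mulr1 subrr.
  rewrite avgB [X in _ - X](_ : _ = 0) ?subr0 //.
  rewrite /avg [X in _ *: X](_ : _ = 0) ?scaler0 //.
  under eq_bigr => z zH do rewrite -scalemxAr mulmxBr Mavg //.
  rewrite -scaler_sumr sumrB sumr_const.
  rewrite [X in _ - X](_ : _ = \sum_(z in pt_stab H) rW z *m v).
    by rewrite subrr scaler0.
  by rewrite /avg -scaler_nat scalerA mulfV ?scale1r.
exists (v - avg v); split=> [|z zH]; first by rewrite linearB /= alphaV a_avg subr0.
exists (alpha H (rW z *m (v - avg v))).
have := avgE (rW z *m (v - avg v)).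
rewrite avgM // avgB [avg (avg v)]avg_id ?a_avg // subrr => /eqP.
by rewrite eq_sym subr_eq0 => /eqP.
Qed.

Definition coroot H : h := xget 0 [set y | alpha H y = 1 /\
  forall z, z \in pt_stab H -> exists a, rW z *m y = a *: y]%classic.

Lemma corootP H : alpha H (coroot H) = 1 /\
  forall z, z \in pt_stab H -> exists a, rW z *m coroot H = a *: coroot H.
Proof. exact: (xgetPex 0 (coroot_exists H)). Qed.

Lemma alpha_coroot H : alpha H (coroot H) = 1.
Proof. by have [] := corootP H. Qed.

(** The projection onto [H] that is equivariant under the stabilizer of [H]. *)
Definition proj H v : h := v - alpha H v *: coroot H.

Lemma alpha_proj H v : alpha H (proj H v) = 0.
Proof. by rewrite linearB linearZ /= alpha_coroot [_ *: _]mulr1 subrr. Qed.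

Lemma proj_linear H : linear (proj H).
Proof.
move=> a u v; rewrite /proj alphaP.
rewrite scalerBr scalerDl opprD addrACA; congr (_ + _).
by rewrite scalerA.
Qed.

(** The stabilizer fixes [H] and scales the coroot; as these span the space, the
factor is the determinant. *)
Lemma pt_stab_mul H z v : z \in pt_stab H ->
  rW z *m v = v + ((wdet z - 1) * alpha H v) *: coroot H.
Proof.
move=> zH; have [_ /(_ z zH)[a za]] := corootP H.
have zv u : rW z *m u = u + ((a - 1) * alpha H u) *: coroot H.
  rewrite -{1}[u](subrK (alpha H u *: coroot H)) mulmxDr.
  rewrite (pt_stabP H z zH _ (alpha_proj H u)) -scalemxAr za scalerA.
  by rewrite -addrA -scaleNr -scalerDl; congr (_ + _ *: _); ring.
suff -> : wdet z = a by exact: zv.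
rewrite /wdet.
pose r : 'rV[F]_n := \row_j alpha H (delta_mx j 0).
have rE u : r *m u = (alpha H u : F)%:M.
  rewrite [LHS]mx11_scalar; congr (_%:M); rewrite mxE.
  rewrite [in RHS](matrix_sum_delta u) linear_sum /=; apply: eq_bigr => j _.
  by rewrite big_ord1 linearZ mxE mulrC.
have -> : rW z = 1%:M + ((a - 1) *: coroot H) *m r.
  apply/matrixP => i j; have := zv (delta_mx j 0).
  rewrite mulrC -scalerA -[X in _ + X]mul_mx_scalar -rE mulmxA.
  rewrite -{2}[delta_mx j 0]mul1mx -mulmxDl -!colE.
  by move=> /(congr1 (fun M : h => M i 0)); rewrite !mxE.
rewrite det_rank1_perturbation rE mxE eqxx mulr1n linearZ /= alpha_coroot.
by rewrite [_ *: _]mulr1 addrC subrK.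
Qed.

Lemma alpha_pt_stab H z v : z \in pt_stab H -> alpha H (rW z *m v) = wdet z * alpha H v.
Proof.
move=> zH; rewrite (pt_stab_mul _ zH) addrC alphaP alpha_coroot mulr1.
by rewrite mulrBl mul1r subrK.
Qed.

Lemma proj_pt_stab H z v : z \in pt_stab H -> proj H (rW z *m v) = proj H v.
Proof.
move=> zH; rewrite /proj alpha_pt_stab // (pt_stab_mul _ zH) -addrA; congr (_ + _).
rewrite -[X in _ + X]scaleNr -[RHS]scaleNr -scalerDl mulrBl mul1r.
by rewrite addrAC subrr sub0r.
Qed.

Lemma wdet_inj H : {in pt_stab H &, injective wdet}.
Proof.
move=> z w zH wH ezw; have zwH : (z * w^-1)%g \in pt_stab H by rewrite groupM ?groupV.
have d1 : wdet (z * w^-1) = 1 by rewrite wdetM wdetV ezw mulfV ?wdet_neq0.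
suff /set1P : (z * w^-1)%g \in [1 W]%g by move/(canRL (mulgKV w)); rewrite mul1g.
have /fintype.subsetP fW : rker rW \subset [1 W]%g := faithful.
apply: fW; apply/rkerP; split; rewrite ?inE //.
apply/matrixP => i j; have := pt_stab_mul (H := H) (delta_mx j 0) zwH.
rewrite d1 subrr mul0r scale0r addr0 -{2}[delta_mx j 0]mul1mx -!colE.
by move=> /(congr1 (fun M : h => M i 0)); rewrite !mxE.
Qed.

Lemma wdet_expn H z : z \in pt_stab H -> wdet z ^+ nH H = 1.
Proof.
move=> zH; have wdetX k : wdet (z ^+ k)%g = wdet z ^+ k.
  by elim: k => [|k IHk]; rewrite ?wdet1 // expgS wdetM IHk exprS.
by rewrite -wdetX (expg_cardG (G := pt_stab_group H)) // wdet1.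
Qed.

(** Otherwise the order of the stabilizer, on which the determinant is injective,
would exceed the number of roots of [X ^ (k mod n_H) - 1]. *)
Lemma wdet_exp_neq1 H k : ~~ (nH H %| k)%N ->
  exists2 z, z \in pt_stab H & wdet z ^+ k != 1.
Proof.
move=> nk; pose r := (k %% nH H)%N.
have r0 : (0 < r)%N by rewrite lt0n.
have rn : (r < nH H)%N by rewrite ltn_mod cardG_gt0.
apply: contrapT => h0.
have p0 : 'X^r - 1 != 0 :> {poly F}.
  by rewrite -size_poly_eq0 size_XnsubC.
have := @max_poly_roots _ ('X^r - 1) [seq wdet z | z <- enum (pt_stab H)] p0.
rewrite size_XnsubC // size_map -cardE ltnS leqNgt rn => /(_ _ _)/notF; apply.
  apply/allP => _ /mapP[z + ->]; rewrite mem_enum => zH.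
  rewrite rootE !hornerE subr_eq0; apply/negPn/negP => d1; apply: h0; exists z => //.
  apply: contra d1; rewrite {1}(divn_eq k (nH H)) exprD mulnC exprM.
  by rewrite (wdet_expn zH) expr1n mul1r.
rewrite map_inj_in_uniq ?enum_uniq // => z w; rewrite !mem_enum.
exact: wdet_inj.
Qed.

Lemma sum_wdet_exp H k :
  \sum_(z in pt_stab H) wdet z ^+ k = if (nH H %| k)%N then (nH H)%:R else 0.
Proof.
case: ifPn => [/dvdnP[q ->]|/wdet_exp_neq1[w wH dw]].
  rewrite (eq_bigr (fun=> 1)) ?sumr_const // => z zH.
  by rewrite mulnC exprM wdet_expn // expr1n.
apply/eqP; rewrite -[_ == 0]orFb -(negbTE dw) -subr_eq0 -mulf_eq0 mulrBl mul1r.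
rewrite subr_eq0; apply/eqP; rewrite mulr_sumr [RHS](reindex_inj (mulgI w)) /=.
apply: eq_big => [z|z _]; first by rewrite groupMl.
by rewrite wdetM exprMn.
Qed.

Lemma translate_exists w H :
  exists H' : hyperplane rW, H' = translate w H :> {vspace h}.
Proof.
have [s sR eH] := hyperplane_reflection H.
have sw : fixedSpace (lin_act rW (w * s * w^-1)) \in
    [seq fixedSpace (lin_act rW s) | s in reflections rW].
  by apply: fintype.image_f; rewrite reflections_conj.
exists (SeqSub sw) => /=; rewrite /translate eH.
apply/vspaceP => v; apply/fixedSpaceP/memv_imgP => [|[u /fixedSpaceP]].
  rewrite lin_actE -mulgA rW_mulmx rW_mulmx => e.
  exists (rW w^-1%g *m v); last by rewrite lin_actE rW_mulKV.
  by apply/fixedSpaceP; rewrite lin_actE -[in RHS]e rW_mulK.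
rewrite lin_actE => e ->.
by rewrite !lin_actE -mulgA rW_mulmx rW_mulmx rW_mulK e.
Qed.

Section Translate.
Variables (w : W) (H H' : hyperplane rW).
Hypothesis eH : H' = translate w H :> {vspace h}.

Lemma alpha_translate_eq0 v : (alpha H' (rW w *m v) == 0) = (alpha H v == 0).
Proof.
rewrite -!mem_hyperplane eH; apply/memv_imgP/idP => [[u uH]|vH]; last first.
  by exists v; rewrite ?lin_actE.
by rewrite lin_actE => /(congr1 (mulmx (rW w^-1%g))); rewrite !rW_mulK => ->.
Qed.

Lemma alpha_translate :
  exists2 a, a != 0 & forall v, alpha H' (rW w *m v) = a * alpha H v.
Proof.
exists (alpha H' (rW w *m coroot H)).
  by rewrite alpha_translate_eq0 alpha_coroot oner_eq0.
move=> v; rewrite -{1}[v](subrK (alpha H v *: coroot H)) mulmxDr -scalemxAr addrC alphaP.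
have /eqP-> : alpha H' (rW w *m proj H v) == 0.
  by rewrite alpha_translate_eq0 alpha_proj.
by rewrite addr0 mulrC.
Qed.

Lemma pt_stab_translate z : (z \in pt_stab H') = (z ^ w \in pt_stab H)%g.
Proof.
apply/pt_stabP/pt_stabP => hz v.
  move=> v0; rewrite conjgE !rW_mulmx hz ?rW_mulK //.
  by apply/eqP; rewrite alpha_translate_eq0 v0.
move=> v0; have /hz : alpha H (rW w^-1%g *m v) = 0.
  by apply/eqP; rewrite -alpha_translate_eq0 rW_mulKV v0.
rewrite conjgE !rW_mulmx rW_mulKV => /(congr1 (mulmx (rW w))).
by rewrite !rW_mulKV.
Qed.

Lemma card_pt_stab_translate : nH H' = nH H.
Proof.
rewrite -!sum1_card [RHS](reindex_inj (conjg_inj w)) /=.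
by apply: eq_bigl => z; exact: pt_stab_translate.
Qed.

End Translate.

End HyperplaneGeometry.

(** * Group action and derivations on regular functions *)

Local Notation "x %:F" := (@FracField.tofrac _ x).

Lemma frac_homD (R : idomainType) (phi : {rmorphism R -> R}) : injective phi ->
  {morph frac_hom phi : x y / x + y}.
Proof.
move=> phiI x y; have [a [b [b0 ->]]] := fracP x.
have [c [e [e0 ->]]] := fracP y.
have phi0 c' : c' != 0 -> phi c' != 0.
  by apply: contra_neq => e'; apply: phiI; rewrite e' rmorph0.
rewrite addf_div ?tofrac_eq0 // -!rmorphM -rmorphD !frac_homE ?mulf_neq0 //.
by rewrite rmorphD !rmorphM /= addf_div ?tofrac_eq0 ?phi0 // !rmorphD !rmorphM.
Qed.

Section RingIdentities.
Variable R : comNzRingType.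
Implicit Types a b c d f g v : R.

Fact commutator_leibniz f g f1 g1 f2 g2 f12 g12 f21 g21 :
  f12 * g + f2 * g1 + (f1 * g2 + f * g12)
    - (f21 * g + f1 * g2 + (f2 * g1 + f * g21)) =
  (f12 - f21) * g + f * (g12 - g21) :> R.
Proof. by ring. Qed.

Fact combination_leibniz a f g f1 g1 f2 g2 :
  a * (f1 * g + f * g1) + (f2 * g + f * g2) =
  (a * f1 + f2) * g + f * (a * g1 + g2).
Proof. by ring. Qed.

Fact clear_denB a b f g : a * b * (f - g) = a * f * b - b * g * a.
Proof. by ring. Qed.

Fact clear_denM a b f g : a * b * (f * g) = a * f * (b * g).
Proof. by ring. Qed.

Fact clear_den_der a b f g : a * a * g = (b * f + a * g) * a - a * f * b.
Proof. by ring. Qed.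

Fact clear_den_act a b c f g :
  a * b * (c * (g - f)) = c * (b * g * a - a * f * b).
Proof. by ring. Qed.

Fact dunkl_term_identity a g d v vk c c' :
  a * (v * vk) * c * (g * d) - a * g * v * (d * vk * c') =
  vk * (a * g * d * (v * (c - c'))) :> R.
Proof. by ring. Qed.

End RingIdentities.

Fact sub_rearrange (V : zmodType) (a b c d : V) :
  a - b + c + d = a + c + (d - b).
Proof. by rewrite (addrAC a) -[LHS]addrA [- b + d]addrC. Qed.

Section RegularFunctions.
Variables (F : numClosedFieldType) (W : finGroupType) (n : nat).
Variable rW : mx_representation F [set: W]%SET n.
Local Notation h := 'cV[F]_n.
Local Notation A := (regfun rW).
Implicit Types (f g : A) (w : W) (y : h) (p q : {mpoly F[n]}) (a : F).

HB.instance Definition _ w := GRing.RMorphism.copy (poly_act rW w)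
  (comp_mpoly [tuple \sum_(j < n) rW w^-1%g i j *: 'X_j | i < n]).

Lemma of_poly_eq0 p : (of_poly rW p == 0) = (p == 0).
Proof. by rewrite -(inj_eq val_inj) /= tofrac_eq0. Qed.

Lemma regfun_mul_eq0 f g : (f * g == 0) = (f == 0) || (g == 0).
Proof. by rewrite -!(inj_eq val_inj) regfun_valM mulf_eq0. Qed.

Lemma regfun_fracP f : exists p q, q != 0 /\ of_poly rW q * f = of_poly rW p.
Proof.
have [p [q [e q0 _]]] := regularP _ _ (valP f).
exists p, q; split=> //; apply: val_inj.
by rewrite regfun_valM e /= mulrC divfK ?tofrac_eq0.
Qed.

Lemma regfun_act_zmod w : zmod_morphism (@regfun_act _ _ _ rW w).
Proof.
have D : {morph @regfun_act _ _ _ rW w : x y / x + y}.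
  move=> f g; apply: val_inj; rewrite regfun_valD !regfun_val_act regfun_valD.
  by rewrite (@frac_homD _ (poly_act rW w)) //; exact: poly_act_inj.
by move=> f g; apply/esym/eqP; rewrite subr_eq -D subrK.
Qed.

Lemma regfun_act_poly w p : regfun_act w (of_poly rW p) = of_poly rW (poly_act rW w p).
Proof.
apply: val_inj; rewrite regfun_val_act /= -[in LHS](divr1 p%:F) -tofrac1.
by rewrite frac_actE ?oner_neq0 // rmorph1 tofrac1 divr1.
Qed.

Lemma regfun_act_monoid w : monoid_morphism (@regfun_act _ _ _ rW w).
Proof.
split=> [|f g]; last exact: regfun_actM.
by rewrite -(rmorph1 (of_poly rW)) regfun_act_poly !rmorph1.
Qed.

HB.instance Definition _ w :=
  GRing.isZmodMorphism.Build A A (regfun_act w) (regfun_act_zmod w).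
HB.instance Definition _ w :=
  GRing.isMonoidMorphism.Build A A (regfun_act w) (regfun_act_monoid w).

Lemma poly_actC w a : poly_act rW w a%:MP = a%:MP.
Proof. exact: comp_mpolyC. Qed.

Lemma regfun_scaleE a f : a *: f = of_poly rW a%:MP * f.
Proof. by []. Qed.

Lemma regfun_actZ w a f : regfun_act w (a *: f) = a *: regfun_act w f.
Proof. by rewrite !regfun_scaleE rmorphM /= regfun_act_poly poly_actC. Qed.

Lemma regfun_actA w w' f : regfun_act w (regfun_act w' f) = regfun_act (w * w') f.
Proof.
have [p [q [q0 e]]] := regfun_fracP f.
have wq0 : of_poly rW (poly_act rW (w * w') q) != 0.
  rewrite of_poly_eq0; apply: contra_neq q0 => e0.
  by apply: (@poly_act_inj _ _ _ rW (w * w')); rewrite e0 rmorph0.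
apply/eqP; rewrite -subr_eq0 -[_ == 0]orFb -(negbTE wq0) -regfun_mul_eq0 mulrBr subr_eq0.
rewrite -[in X in _ == X]regfun_act_poly -rmorphM /= e regfun_act_poly.
have wE r : of_poly rW (poly_act rW (w * w') r) =
    regfun_act w (regfun_act w' (of_poly rW r)).
  by rewrite [regfun_act w' _]regfun_act_poly regfun_act_poly poly_actM.
by rewrite (wE q) (wE p) -(rmorphM (regfun_act w)) -(rmorphM (regfun_act w')) e.
Qed.

Lemma regfun_act1 f : regfun_act 1 f = f.
Proof.
have [p [q [q0 e]]] := regfun_fracP f.
have q0' : (of_poly rW q == 0) = false by rewrite of_poly_eq0 (negbTE q0).
apply/eqP; rewrite -subr_eq0; rewrite -[_ == 0]orFb -q0' -regfun_mul_eq0 mulrBr subr_eq0.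
rewrite -{1}[q](@poly_act1 _ _ _ rW) -regfun_act_poly -rmorphM /= e.
by rewrite regfun_act_poly poly_act1.
Qed.

Lemma regfun_der_zmod y : zmod_morphism (@regfun_der _ _ _ rW y).
Proof. by move=> f g; apply/esym/eqP; rewrite subr_eq -regfun_derD subrK. Qed.
HB.instance Definition _ y :=
  GRing.isZmodMorphism.Build A A (regfun_der y) (regfun_der_zmod y).

Lemma regfun_der_poly y p : regfun_der y (of_poly rW p) = of_poly rW (poly_der y p).
Proof.
apply: val_inj; rewrite regfun_val_der /= -[in LHS](divr1 p%:F) -tofrac1.
rewrite frac_derE ?oner_neq0 //; last exact: poly_derM.
have -> : poly_der y 1 = 0 :> {mpoly F[n]}.
  by rewrite -mpolyC1 /poly_der big1 // => i _; rewrite mderivC scaler0.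
by rewrite mulr0 subr0 mulr1 expr1n tofrac1 divr1.
Qed.

Lemma regfun_derZ y a f : regfun_der y (a *: f) = a *: regfun_der y f.
Proof. by have := regfun_der_linear y a f 0; rewrite !addr0 raddf0 addr0. Qed.

(** A derivation twisted by an automorphism extends in at most one way from
polynomials to regular functions: clear denominators. *)
Lemma regfun_derivation_eq w (d1 d2 : A -> A) :
    (forall f g, d1 (f * g) = d1 f * regfun_act w g + regfun_act w f * d1 g) ->
    (forall f g, d2 (f * g) = d2 f * regfun_act w g + regfun_act w f * d2 g) ->
    (forall p, d1 (of_poly rW p) = d2 (of_poly rW p)) ->
  d1 =1 d2.
Proof.
move=> D1 D2 e12 f; have [p [q [q0 e]]] := regfun_fracP f.
have wq0 : (regfun_act w (of_poly rW q) == 0) = false.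
  rewrite regfun_act_poly of_poly_eq0; apply: contra_neqF q0 => /eqP e0.
  by apply: (@poly_act_inj _ _ _ rW w); rewrite e0 rmorph0.
apply/eqP; rewrite -subr_eq0 -[_ == 0]orFb -wq0 -regfun_mul_eq0 mulrBr subr_eq0.
have := D1 (of_poly rW q) f; rewrite e e12 -e D2 e12 => /addrI->.
exact: eqxx.
Qed.

Lemma regfun_der_comm y y' f :
  regfun_der y (regfun_der y' f) = regfun_der y' (regfun_der y f).
Proof.
apply/eqP; rewrite -subr_eq0; apply/eqP.
apply: (@regfun_derivation_eq 1 (fun f => regfun_der y (regfun_der y' f) -
  regfun_der y' (regfun_der y f)) (fun=> 0)) => [{}f g|{}f g|p].
- rewrite !regfun_act1 !regfun_derM !regfun_derD !regfun_derM.
  exact: commutator_leibniz.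
- by rewrite mul0r mulr0 addr0.
rewrite !regfun_der_poly -rmorphB /=.
have -> : poly_der y (poly_der y' p) = poly_der y' (poly_der y p).
  rewrite /poly_der.
  under eq_bigr => i _ do rewrite (raddf_sum (mderiv i)) /= scaler_sumr.
  under [RHS]eq_bigr => i _ do rewrite (raddf_sum (mderiv i)) /= scaler_sumr.
  rewrite exchange_big; apply: eq_bigr => i _; apply: eq_bigr => j _.
  by rewrite /= !mderivZ !scalerA mulrC mderiv_comm.
by rewrite subrr rmorph0.
Qed.

Lemma regfun_der_act w y f :
  regfun_act w (regfun_der y f) = regfun_der (rW w *m y) (regfun_act w f).
Proof.
apply: (@regfun_derivation_eq w (fun f => regfun_act w (regfun_der y f))
  (fun f => regfun_der (rW w *m y) (regfun_act w f))) => [{}f g|{}f g|p].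
- by rewrite regfun_derM rmorphD !rmorphM.
- by rewrite rmorphM /= regfun_derM.
rewrite regfun_der_poly !regfun_act_poly regfun_der_poly; congr of_poly.
have derX u i : poly_der u ('X_i : {mpoly F[n]}) = (u i 0)%:MP.
  rewrite /poly_der (bigD1 i) //= big1 => [|j ji].
    by rewrite addr0 mderivXU eqxx -mul_mpolyC mulr1.
  by rewrite mderivXU eq_sym (negbTE ji) scaler0.
have derC u c : poly_der u (c%:MP : {mpoly F[n]}) = 0.
  by rewrite /poly_der big1 // => i _; rewrite mderivC scaler0.
have derD u : {morph @poly_der F n u : p q / p + q}.
  by move=> p1 p2; have := poly_der_linear u 1 p1 p2; rewrite !scale1r.
have derZ u c (q : {mpoly F[n]}) : poly_der u (c *: q) = c *: poly_der u q.
  by rewrite -!mul_mpolyC poly_derM derC mul0r add0r.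
elim/mpoly_ind_mul: p => [p q ep eq|c|p i ep].
- by rewrite !(derD, rmorphD) /= ep eq.
- by rewrite derC rmorph0 poly_actC derC.
rewrite !(poly_derM, rmorphD, rmorphM) /= ep; congr (_ + _ * _).
rewrite derX poly_actC /poly_act comp_mpolyXU -tnth_nth tnth_mktuple.
have der0 u : poly_der u (0 : {mpoly F[n]}) = 0 by rewrite -mpolyC0 derC.
rewrite (big_morph _ (derD _) (der0 _)).
under eq_bigr => j _ do rewrite derZ derX -mul_mpolyC -mpolyCM.
rewrite -rmorph_sum /=; congr (_%:MP).
by have := rW_mulK rW w y => /(congr1 (fun M : h => M i 0)); rewrite mxE => ->.
Qed.

Lemma regfun_der_lin f a y y' :
  regfun_der (a *: y + y') f = a *: regfun_der y f + regfun_der y' f.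
Proof.
apply: (@regfun_derivation_eq 1 (fun f => regfun_der (a *: y + y') f)
  (fun f => a *: regfun_der y f + regfun_der y' f)) => [{}f g|{}f g|p].
- by rewrite !regfun_act1 regfun_derM.
- rewrite !regfun_act1 !regfun_derM !regfun_scaleE.
  exact: combination_leibniz.
rewrite !regfun_der_poly regfun_scaleE -rmorphM -rmorphD /=; congr of_poly.
rewrite mul_mpolyC /poly_der scaler_sumr -big_split; apply: eq_bigr => i _.
by rewrite !mxE scalerDl scalerA.
Qed.

End RegularFunctions.

(** * Regular functions without a pole along a hyperplane *)

Section NoPole.
Variables (F : numClosedFieldType) (W : finGroupType) (n : nat).
Variable rW : mx_representation F [set: W]%SET n.
Variable alpha : hyperplane rW -> 'Hom('cV[F]_n, F^o).
Local Notation h := 'cV[F]_n.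
Local Notation A := (regfun rW).
Local Notation nH H := #|pt_stab H|.
Implicit Types (H : hyperplane rW) (f g : A) (w z : W) (y v : h) (p q : {mpoly F[n]}).

(** Restriction to [H], with values in the functions on the whole space that factor
through the projection to [H]. *)
Definition res H : {mpoly F[n]} -> {mpoly F[n]} := proj_poly (alpha H) (coroot alpha H).
HB.instance Definition _ H :=
  GRing.RMorphism.copy (res H) (proj_poly (alpha H) (coroot alpha H)).

Lemma poly_at_res H p v : poly_at (res H p) v = poly_at p (proj alpha H v).
Proof. exact: poly_at_proj. Qed.

(** The regular functions whose denominator can be chosen not to vanish identically
on [H]: those in the valuation ring of [H]. *)
Definition no_pole H : {pred A} := fun f =>
  `[< exists p q, of_poly rW q * f = of_poly rW p /\ res H q != 0 >].

Lemma no_poleP H f : reflect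
  (exists p q, of_poly rW q * f = of_poly rW p /\ res H q != 0) (f \in no_pole H).
Proof. exact: asboolP. Qed.

Lemma no_pole_poly H p : of_poly rW p \in no_pole H.
Proof. by apply/no_poleP; exists p, 1; rewrite !rmorph1 mul1r oner_neq0. Qed.

Lemma no_pole_subring H : subring_closed (no_pole H).
Proof.
split; first by rewrite -(rmorph1 (of_poly rW)) no_pole_poly.
- move=> f g /no_poleP[p [q [e q0]]] /no_poleP[p' [q' [e' q'0]]]; apply/no_poleP.
  exists (p * q' - p' * q), (q * q'); split; last by rewrite rmorphM mulf_neq0.
  by rewrite !(rmorphM, rmorphB) /= -e -e'; exact: clear_denB.
- move=> f g /no_poleP[p [q [e q0]]] /no_poleP[p' [q' [e' q'0]]]; apply/no_poleP.
  exists (p * p'), (q * q'); split; last by rewrite rmorphM mulf_neq0.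
  by rewrite !rmorphM /= -e -e'; exact: clear_denM.
Qed.

HB.instance Definition _ H :=
  GRing.isSubringClosed.Build A (no_pole H) (no_pole_subring H).

Lemma no_poleZ H a f : f \in no_pole H -> a *: f \in no_pole H.
Proof. by move=> fH; rewrite regfun_scaleE rpredM ?no_pole_poly. Qed.

Lemma no_pole_der H y f : f \in no_pole H -> regfun_der y f \in no_pole H.
Proof.
move=> /no_poleP[p [q [e q0]]]; apply/no_poleP.
exists (poly_der y p * q - p * poly_der y q), (q * q).
split; last by rewrite rmorphM mulf_neq0.
rewrite !(rmorphM, rmorphB) /= -!regfun_der_poly -e regfun_derM.
exact: clear_den_der.
Qed.

Definition alpha_fun H : A := of_poly rW (lform_poly (alpha H)).
Definition alphaV H : A := (alpha_fun H)^-1.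

Hypothesis ker_alpha : forall H : hyperplane rW, lker (alpha H) = H.

Lemma alpha_fun_unit H : alpha_fun H \is a GRing.unit.
Proof. exact: lform_poly_unit. Qed.

Lemma mul_alphaV H : alpha_fun H * alphaV H = 1.
Proof. by rewrite mulrV ?alpha_fun_unit. Qed.

Lemma regfun_der_alpha_fun H y : regfun_der y (alpha_fun H) = (alpha H y : F) *: 1.
Proof.
rewrite regfun_der_poly regfun_scaleE mulr1; congr of_poly.
apply: poly_at_eq => v; rewrite /poly_at mevalC /poly_der raddf_sum /=.
rewrite [in RHS](matrix_sum_delta y) linear_sum /=; apply: eq_bigr => i _.
rewrite big_ord1 [in RHS]linearZ mevalZ; congr (_ * _).
rewrite /lform_poly (raddf_sum (mderiv i)) /= raddf_sum (bigD1 i) //= big1 => [|j ji].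
  by rewrite mderivZ mevalZ mderivXU eqxx meval1 mulr1 addr0.
by rewrite mderivZ mevalZ mderivXU (negbTE ji) meval0 mulr0.
Qed.

Lemma regfun_der1 y : regfun_der y 1 = 0 :> A.
Proof. by rewrite -(rmorph1 (of_poly rW)) -mpolyC1 regfun_derC. Qed.

Lemma regfun_der_alphaVX H y k :
  regfun_der y (alphaV H ^+ k) = - (k%:R * alpha H y : F) *: alphaV H ^+ k.+1.
Proof.
have dav : regfun_der y (alphaV H) = - (alpha H y : F) *: alphaV H ^+ 2.
  have := congr1 (regfun_der y) (mul_alphaV H); rewrite regfun_derM regfun_der_alpha_fun.
  rewrite regfun_der1.
  move=> /(congr1 ( *%R (alphaV H))); rewrite mulr0 mulrDr.
  rewrite [alphaV H * (alpha_fun H * _)]mulrA [alphaV H * alpha_fun H]mulrC.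
  rewrite mul_alphaV mul1r.
  move=> /eqP; rewrite addrC addr_eq0 => /eqP->.
  by rewrite -scalerAl mul1r -scalerAr scaleNr expr2.
elim: k => [|k IHk].
  by rewrite expr0 mul0r oppr0 scale0r regfun_der1.
rewrite exprS regfun_derM IHk dav -scalerAl -scalerAr -exprD add2n -exprS -scalerDl.
by rewrite -natr1 mulrDl mul1r opprD addrC.
Qed.

Lemma lform_poly_neq0 H : lform_poly (alpha H) != 0.
Proof.
apply/eqP => a0; have := mul_alphaV H.
by rewrite /alpha_fun a0 rmorph0 mul0r => /eqP; rewrite eq_sym oner_eq0.
Qed.

Lemma res_eq0 H p : res H p = 0 <-> exists q, p = lform_poly (alpha H) * q.
Proof. by apply: proj_poly_eq0; exact: alpha_coroot. Qed.

Lemma act_alphaV w H H' a : a != 0 -> (forall v, alpha H' (rW w *m v) = a * alpha H v) ->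
  regfun_act w (alphaV H) = a *: alphaV H'.
Proof.
move=> a0 ea; have e : regfun_act w (alpha_fun H) = a^-1 *: alpha_fun H'.
  rewrite regfun_act_poly regfun_scaleE -rmorphM; congr of_poly.
  apply: poly_at_eq => v; rewrite poly_at_act /poly_at mevalM mevalC.
  rewrite -!/(poly_at _ _) !poly_at_lform -{2}[v](rW_mulKV rW w) ea.
  by rewrite mulrA mulVf ?mul1r.
have e1 : regfun_act w (alpha_fun H) * regfun_act w (alphaV H) = 1.
  by rewrite -rmorphM mul_alphaV rmorph1.
have : (a *: alphaV H') *
    (regfun_act w (alpha_fun H) * regfun_act w (alphaV H)) = a *: alphaV H'.
  by rewrite e1 mulr1.
rewrite e => <-; rewrite mulrA -[LHS]mul1r; congr (_ * _).
rewrite -regfun_scaleAl -scalerAr scalerA mulfV // scale1r mulrC.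
by rewrite mul_alphaV.
Qed.

Lemma act_alphaVX H z k : z \in pt_stab H ->
  regfun_act z (alphaV H ^+ k) = wdet rW z ^+ k *: alphaV H ^+ k.
Proof.
move=> zH; rewrite rmorphXn /= (@act_alphaV z H H (wdet rW z)) ?wdet_neq0 //.
  by rewrite exprZn.
by move=> v; rewrite alpha_pt_stab.
Qed.

Lemma no_pole_alphaV H H' : H' != H -> alphaV H' \in no_pole H.
Proof.
move=> neH; apply/no_poleP; exists 1, (lform_poly (alpha H')).
rewrite rmorph1; split; first exact: mul_alphaV.
apply: contra_neq neH => /res_eq0[q e]; apply/val_inj.
have sH : (H <= H')%VS.
  apply/subvP => v; rewrite !(mem_hyperplane ker_alpha) -!poly_at_lform e.
  by rewrite /poly_at mevalM mulf_eq0 => ->.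
apply/esym/eqP; rewrite eqEdim sH /=.
by rewrite -ltnS (dim_hyperplane H') (dim_hyperplane H).
Qed.

(** The stabilizer fixes [H] pointwise, so [z f - f] vanishes on [H]. *)
Lemma no_pole_act_sub H z f : z \in pt_stab H -> f \in no_pole H ->
  alphaV H * (regfun_act z f - f) \in no_pole H.
Proof.
move=> zH /no_poleP[p [q [e q0]]].
have res_act r : res H (poly_act rW z r) = res H r.
  apply: poly_at_eq => v; rewrite [LHS]poly_at_res [RHS]poly_at_res poly_at_act.
  congr (poly_at r _).
  have zVH : z^-1%g \in pt_stab H by rewrite (groupV (pt_stab_group H)).
  by rewrite (pt_stabP ker_alpha H _ zVH) // alpha_proj.
have [r er] : exists r,
    poly_act rW z p * q - p * poly_act rW z q = lform_poly (alpha H) * r.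
  by apply/res_eq0; rewrite rmorphB !rmorphM /= !res_act subrr.
apply/no_poleP; exists r, (q * poly_act rW z q); split; last first.
  by rewrite rmorphM /= res_act mulf_neq0.
have ez : of_poly rW (poly_act rW z q) * regfun_act z f = of_poly rW (poly_act rW z p).
  by rewrite -!regfun_act_poly -rmorphM e.
have := congr1 (of_poly rW) er; rewrite rmorphB !rmorphM /= -ez -e -/(alpha_fun H) => er'.
move/(congr1 ( *%R (alphaV H))): er'.
rewrite [in RHS]mulrA [alphaV H * alpha_fun H]mulrC mul_alphaV mul1r => <-.
exact: clear_den_act.
Qed.

Lemma no_pole_act H z f :
  z \in pt_stab H -> f \in no_pole H -> regfun_act z f \in no_pole H.
Proof.
move=> zH fH; rewrite -[regfun_act z f](subrK f) rpredD //.
rewrite -[_ - f]mul1r -(mul_alphaV H) -mulrA rpredM ?no_pole_poly //.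
exact: no_pole_act_sub.
Qed.

(** By [no_pole_act_sub], a function without a pole on which the stabilizer acts
through a nontrivial character vanishes on [H]. Division by [alpha] multiplies the
character by the determinant, and this can be repeated until the character becomes
trivial. *)
Lemma no_pole_semi_invariant H k f : mx_faithful rW -> f \in no_pole H ->
    (forall z, z \in pt_stab H -> wdet rW z ^+ k *: regfun_act z f = f) ->
  alphaV H ^+ (k %% nH H) * f \in no_pole H.
Proof.
move=> faithful fH semi; set r := (k %% nH H)%N.
have rn : (r < nH H)%N by rewrite ltn_mod (cardG_gt0 (pt_stab_group H)).
suff h0 i : (i <= r)%N -> alphaV H ^+ i * f \in no_pole H by exact: h0.
elim: i => [|i IHi] ir; first by rewrite expr0 mul1r.
have {}IHi := IHi (ltnW ir).
have [z zH dz] : exists2 z, z \in pt_stab H & wdet rW z ^+ (r - i) != 1.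
  apply: (wdet_exp_neq1 faithful ker_alpha); apply/negP => /dvdn_leq.
  rewrite subn_gt0 ir leqNgt => /(_ isT)/negP; apply.
  by rewrite (leq_ltn_trans (leq_subr _ _)).
have ri : (i <= r)%N := ltnW ir.
have edz : wdet rW z ^+ k = wdet rW z ^+ r.
  by rewrite {1}(divn_eq k (nH H)) exprD mulnC exprM (wdet_expn zH) expr1n mul1r.
have e1 : wdet rW z ^+ (r - i) *: regfun_act z (alphaV H ^+ i * f) = alphaV H ^+ i * f.
  rewrite rmorphM /= act_alphaVX // -scalerAl scalerA -exprD subnK //.
  by rewrite -edz scalerAr semi.
have := no_pole_act_sub zH IHi; set g := alphaV H ^+ i * f in e1 *.
have -> : regfun_act z g - g = (wdet rW z ^- (r - i) - 1) *: g.
  rewrite scalerBl scale1r; congr (_ - _); rewrite -[in RHS]e1 scalerA mulVf ?scale1r //.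
  by rewrite expf_neq0 ?wdet_neq0.
rewrite -scalerAr => /(no_poleZ (wdet rW z ^- (r - i) - 1)^-1).
rewrite scalerA mulVf ?scale1r; first by rewrite /g mulrA -exprS.
by rewrite subr_eq0 invr_eq1.
Qed.

(** Divide the denominator by the linear forms of the hyperplanes on which it
vanishes, which also divide the numerator as there is no pole. What remains of the
denominator vanishes identically on no hyperplane and nowhere off the hyperplanes,
so it is constant. *)
Lemma no_pole_all_poly f : (forall H, f \in no_pole H) -> exists p, f = of_poly rW p.
Proof.
move=> fH; have [p [q [e q0 qreg]]] := regularP _ _ (valP f).
have {}e : of_poly rW q * f = of_poly rW p.
  by apply: val_inj; rewrite regfun_valM e /= mulrC divfK ?tofrac_eq0.
have {}qreg v : (forall H, alpha H v != 0) -> poly_at q v != 0.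
  by move=> hv; apply: qreg => H; rewrite (mem_hyperplane ker_alpha) hv.
have [d] := ubnP (msize q); elim: d => // d IHd in p q e q0 qreg *; rewrite ltnS => qd.
have [q1|q1] := leqP (msize q) 1.
  have [c c0 ec] : exists2 c, c != 0 & q = c%:MP.
    by apply/msize_poly1P; rewrite eqn_leq q1 lt0n msize_poly_eq0.
  exists (c^-1 *: p); rewrite -mul_mpolyC rmorphM /= -e ec mulrA -rmorphM /=.
  by rewrite -mpolyCM mulVf // mpolyC1 rmorph1 mul1r.
have [H [q' eq]] := lform_dvd_of_nonvanishing lform_poly_neq0 qreg q1.
have [p2 [q2 [e2 q20]]] := no_poleP _ _ (fH H).
have e3 : p * q2 = p2 * q.
  apply/eqP; rewrite -subr_eq0 -(of_poly_eq0 rW) rmorphB !rmorphM /= -e -e2.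
  by rewrite subr_eq0 mulrC mulrA mulrAC.
have [p' ep] : exists p', p = lform_poly (alpha H) * p'.
  apply/res_eq0; apply: (mulIf q20); rewrite mul0r -rmorphM /= e3.
  by apply/res_eq0; exists (p2 * q'); rewrite eq; ring.
have q'0 : q' != 0 by apply: contra_neq q0; rewrite eq => ->; rewrite mulr0.
apply: (IHd p' q') => //.
- move: e; rewrite eq ep !rmorphM /= -/(alpha_fun H) -mulrA.
  move/(congr1 ( *%R (alphaV H))).
  by rewrite !mulrA -[alphaV H * _]mulrC mul_alphaV !mul1r.
- move=> v /qreg; rewrite eq; apply: contra => /eqP e0.
  by rewrite /poly_at mevalM -!/(poly_at _ v) e0 mulr0.
apply: leq_trans qd; rewrite eq msizeM ?lform_poly_neq0 //.
have : (1 < msize (lform_poly (alpha H)))%N; last first.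
  by case: (msize _) => [|[|k]] // _; rewrite !addSn /= ltnS leq_addl.
rewrite ltnNge; apply: contra (lform_poly_neq0 H) => /msize1_polyC ec.
have := poly_at_lform (alpha H) 0; rewrite linear0 ec /poly_at mevalC => ->.
by rewrite mpolyC0.
Qed.

End NoPole.

(** * Full symbols of differential operators *)

(** Bounds on degrees propagate from the variables to all polynomials; [D d x] reads:
 [x] has degree less than [d]. *)
Lemma mmap_graded n (R : comNzRingType) (S : comNzRingType) (f : {rmorphism R -> S})
    (h : 'I_n -> S) (D : nat -> S -> Prop) :
    (forall d, D d 0) -> (forall d x y, D d x -> D d y -> D d (x + y)) ->
    (forall d e x, (d <= e)%N -> D d x -> D e x) -> (forall c, D 1%N (f c)) ->
    (forall d x i, D d x -> D d.+1 (x * h i)) ->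
  forall p, D (msize p) (mmap f h p).
Proof.
move=> D0 DD Dle Df Dh p.
have Dm c m : D (mdeg m).+1 (f c * mmap1 h m).
  elim/mnm_ind: m => [|m i IHm]; first by rewrite mmap11 mulr1 mdeg0.
  rewrite commr_mmap1_M => [|j x]; last exact: mulrC.
  by rewrite mmap1U mulrA mdegD mdeg1 addn1; exact: Dh.
rewrite /mmap; have : {subset msupp p <= msupp p} by [].
elim: {-2}(msupp p) => [|m r IHr] sr; first by rewrite big_nil.
rewrite big_cons; apply: DD; last by apply: IHr => x xr; rewrite sr // inE xr orbT.
by apply: Dle (Dm _ _); apply: msize_mdeg_lt; rewrite sr // mem_head.
Qed.

Fact sym_der_key : unit. Proof. exact: tt. Qed.
Fact sym_act_key : unit. Proof. exact: tt. Qed.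
Fact Op_key : unit. Proof. exact: tt. Qed.

Section Symbols.
Variables (F : numClosedFieldType) (W : finGroupType) (n : nat).
Variable rW : mx_representation F [set: W]%SET n.
Local Notation h := 'cV[F]_n.
Local Notation A := (regfun rW).
Local Notation K := {mpoly (regfun rW)[n]}.
Local Notation e_ i := (delta_mx i 0 : h).
Implicit Types (f g : A) (w z : W) (y v : h) (P Q : K) (a : F).

Definition lin_sym y : K := \sum_i (y i 0)%:A *: 'X_i.

Lemma lin_symP a y y' : lin_sym (a *: y + y') = a%:A *: lin_sym y + lin_sym y'.
Proof.
rewrite /lin_sym scaler_sumr -big_split; apply: eq_bigr => i _.
by rewrite !mxE scalerDl scalerDl scalerA mulr_algl scalerA.
Qed.

Lemma lin_sym0 : lin_sym 0 = 0.
Proof. by rewrite /lin_sym big1 // => i _; rewrite mxE scale0r scale0r. Qed.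

Lemma lin_symZ a y : lin_sym (a *: y) = a%:A *: lin_sym y.
Proof. by have := lin_symP a y 0; rewrite lin_sym0 !addr0. Qed.

Lemma lin_symD y y' : lin_sym (y + y') = lin_sym y + lin_sym y'.
Proof. by have := lin_symP 1 y y'; rewrite !scale1r. Qed.

Lemma lin_sym_delta i : lin_sym (e_ i) = 'X_i.
Proof.
rewrite /lin_sym (bigD1 i) //= big1 => [|j ji];
  rewrite mxE ?eqxx ?scale1r ?scale1r ?addr0 //.
by rewrite (negbTE ji) !scale0r.
Qed.

Definition sym_der y : K -> K := locked_with sym_der_key (map_mpoly (regfun_der y)).

Lemma mcoeff_sym_der y P m : (sym_der y P)@_m = regfun_der y P@_m.
Proof. by rewrite /sym_der unlock [LHS]mcoeff_map_mpoly. Qed.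

Lemma sym_der_zmod y : zmod_morphism (sym_der y).
Proof. by rewrite /sym_der unlock => P Q; rewrite raddfB. Qed.
HB.instance Definition _ y := GRing.isZmodMorphism.Build K K (sym_der y) (sym_der_zmod y).

Lemma sym_derD y P Q : sym_der y (P + Q) = sym_der y P + sym_der y Q.
Proof. exact: (raddfD (sym_der y)). Qed.

Lemma sym_derC y c : sym_der y c%:MP = (regfun_der y c)%:MP.
Proof. by rewrite /sym_der unlock map_mpolyC. Qed.

Lemma sym_derM y P Q : sym_der y (P * Q) = sym_der y P * Q + P * sym_der y Q.
Proof.
apply/mpolyP => m; rewrite mcoeff_sym_der mcoeffD !mcoeffM raddf_sum /= -big_split.
apply: eq_bigr => k _ /=.
by rewrite regfun_derM !mcoeff_sym_der.
Qed.

Lemma sym_derX y m : sym_der y 'X_[m] = 0.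
Proof.
apply/mpolyP => k; rewrite mcoeff_sym_der mcoeff0 mcoeffX.
by case: (m == k); rewrite ?raddf0 //; exact: regfun_der1.
Qed.

Lemma sym_derZ y c P : sym_der y (c *: P) = regfun_der y c *: P + c *: sym_der y P.
Proof. by rewrite -!mul_mpolyC sym_derM sym_derC. Qed.

Lemma sym_der_alg y a P : sym_der y (a%:A *: P) = a%:A *: sym_der y P.
Proof. by rewrite sym_derZ regfun_derZ regfun_der1 scaler0 scale0r add0r. Qed.

Lemma sym_der_lin_sym y y' : sym_der y (lin_sym y') = 0.
Proof. by rewrite raddf_sum big1 // => i _ /=; rewrite sym_der_alg sym_derX scaler0. Qed.

(** Conjugation of differential operators by [w], on symbols: it transforms the
derivations along with the coefficients. *)
Definition sym_act w : K -> K :=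
  locked_with sym_act_key
    (mmap (@mpolyC n A \o regfun_act w) (fun i => lin_sym (rW w *m e_ i))).

Lemma sym_act_zmod w : zmod_morphism (sym_act w).
Proof. by rewrite /sym_act unlock => P Q; rewrite raddfB. Qed.
Lemma sym_act_monoid w : monoid_morphism (sym_act w).
Proof. by rewrite /sym_act unlock; split=> [|P Q]; rewrite ?rmorph1 ?rmorphM. Qed.
HB.instance Definition _ w := GRing.isZmodMorphism.Build K K (sym_act w) (sym_act_zmod w).
HB.instance Definition _ w :=
  GRing.isMonoidMorphism.Build K K (sym_act w) (sym_act_monoid w).

Lemma sym_actD w P Q : sym_act w (P + Q) = sym_act w P + sym_act w Q.
Proof. exact: (raddfD (sym_act w)). Qed.

Lemma sym_actM w P Q : sym_act w (P * Q) = sym_act w P * sym_act w Q.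
Proof. exact: (rmorphM (sym_act w)). Qed.

Lemma sym_actC w c : sym_act w c%:MP = (regfun_act w c)%:MP.
Proof. by rewrite /sym_act unlock mmapC. Qed.

Lemma sym_actZ w c P : sym_act w (c *: P) = regfun_act w c *: sym_act w P.
Proof. by rewrite -!mul_mpolyC rmorphM /= sym_actC. Qed.

Lemma regfun_act_alg w a : regfun_act w (a%:A : A) = a%:A.
Proof. by rewrite regfun_actZ rmorph1. Qed.

Lemma sym_actX w i : sym_act w 'X_i = lin_sym (rW w *m e_ i).
Proof. by rewrite /sym_act unlock mmapX mmap1U. Qed.

Lemma sym_act_lin_sym w y : sym_act w (lin_sym y) = lin_sym (rW w *m y).
Proof.
rewrite raddf_sum /=.
under eq_bigr => i _ do rewrite sym_actZ regfun_act_alg sym_actX -lin_symZ.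
rewrite -(big_morph _ lin_symD lin_sym0); congr lin_sym.
rewrite [in RHS](matrix_sum_delta y) mulmx_sumr; apply: eq_bigr => i _.
by rewrite big_ord1 -scalemxAr.
Qed.

Lemma sym_actA w w' P : sym_act w (sym_act w' P) = sym_act (w * w') P.
Proof.
apply: (mpoly_rmorph_eq (f := sym_act w \o sym_act w')
  (g := sym_act (w * w'))) => [c|i] /=.
  by rewrite !sym_actC regfun_actA.
by rewrite !sym_actX sym_act_lin_sym rW_mulmx.
Qed.

Lemma sym_act1 P : sym_act 1 P = P.
Proof.
apply: (mpoly_rmorph_eq (f := sym_act 1) (g := idfun)) => [c|i] /=.
  by rewrite sym_actC regfun_act1.
by rewrite sym_actX repr_mx1 mul1mx lin_sym_delta.
Qed.

Lemma sym_act_der w y P : sym_act w (sym_der y P) = sym_der (rW w *m y) (sym_act w P).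
Proof.
elim/mpoly_ind_mul: P => [P Q eP eQ|c|P i eP].
- by rewrite sym_derD !sym_actD sym_derD eP eQ.
- by rewrite sym_derC !sym_actC sym_derC regfun_der_act.
rewrite sym_derM sym_derX mulr0 addr0 !sym_actM sym_derM eP sym_actX sym_der_lin_sym.
by rewrite mulr0 addr0.
Qed.

Lemma msize_lin_sym y : (msize (lin_sym y) <= 2)%N.
Proof.
apply/msize_leP => m m2; rewrite /lin_sym raddf_sum big1 // => i _ /=.
rewrite mcoeffZ mcoeffX; case: eqP => [em|]; rewrite ?mulr0 //.
by rewrite -em mdeg1 in m2.
Qed.

Lemma msizeM_lin_sym P y d : (msize P <= d)%N -> (msize (P * lin_sym y) <= d.+1)%N.
Proof.
by move=> Pd; rewrite -addn1; apply: msizeM_leq Pd _; exact: msize_lin_sym.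
Qed.

Lemma msize_sym_act w P : (msize (sym_act w P) <= msize P)%N.
Proof.
rewrite /sym_act unlock.
apply: (@mmap_graded _ _ _ (@mpolyC n A \o regfun_act w) _ (fun d Q => msize Q <= d)%N).
- by move=> d; rewrite msize0.
- by move=> d x y; exact: msizeD_leq.
- by move=> d e x de xd; exact: leq_trans de.
- by move=> c; rewrite /= msizeC leq_b1.
by move=> d x i; exact: msizeM_lin_sym.
Qed.

Lemma msize_sym_der y P : (msize (sym_der y P) <= msize P)%N.
Proof.
by apply/msize_leP => m Pm; rewrite mcoeff_sym_der (msize_leP _ _ (leqnn _) _ Pm) raddf0.
Qed.

Fixpoint der_list (s : seq 'I_n) (m : 'X_{1..n}) f : A :=
  if s is i :: s' then iter (m i) (regfun_der (e_ i)) (der_list s' m f) else f.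

Definition der_mon m f := der_list (enum 'I_n) m f.

Lemma der_list_comm s m y f :
  der_list s m (regfun_der y f) = regfun_der y (der_list s m f).
Proof.
elim: s => //= i s ->; elim: (m i) => //= k ->.
exact: regfun_der_comm.
Qed.

Lemma der_listU s m i f : uniq s ->
  der_list s (m + U_(i)) f =
  if i \in s then regfun_der (e_ i) (der_list s m f) else der_list s m f.
Proof.
elim: s => //= j s IHs /andP[js us]; rewrite IHs // inE mnmDE mnm1E.
have [ij|ij] := eqVneq i j; first by rewrite ij (negbTE js) addn1 iterS.
rewrite addn0 /=; case: ifP => // _.
by elim: (m j) => //= k ->; exact: regfun_der_comm.
Qed.

Lemma der_monU m i f : der_mon (m + U_(i)) f = der_mon m (regfun_der (e_ i) f).
Proof. by rewrite /der_mon der_listU ?enum_uniq // mem_enum der_list_comm. Qed.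

Lemma der_mon0 f : der_mon 0 f = f.
Proof.
by rewrite /der_mon; elim: (enum _) => //= i s ->; rewrite mnm0E.
Qed.

(** Coefficients are written to the left of derivatives. *)
Definition Op P f : A :=
  locked_with Op_key (fun P f => \sum_(m <- msupp P) P@_m * der_mon m f) P f.

Lemma OpE d P f : (msize P <= d)%N ->
  Op P f = \sum_(m : 'X_{1..n < d}) P@_m * der_mon m f.
Proof.
move=> le_Pd; rewrite /Op unlock; set I : subFinType _ := 'X_{1..n < d}.
rewrite (big_mksub I) ?msupp_uniq //=; last first.
  by move=> x /msize_mdeg_lt /leq_trans; apply.
by rewrite big_rmcond //= => j /memN_msupp_eq0 ->; rewrite mul0r.
Qed.

Lemma OpD P Q f : Op (P + Q) f = Op P f + Op Q f.
Proof.
pose d := maxn (msize P) (msize Q).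
rewrite !(@OpE d) ?msizeD_le ?leq_maxl ?leq_maxr //.
by rewrite -big_split; apply: eq_bigr => m _; rewrite mcoeffD mulrDl.
Qed.

Lemma OpZ c P f : Op (c *: P) f = c * Op P f.
Proof.
rewrite !(@OpE (msize P)) ?msizeZ_le // mulr_sumr.
by apply: eq_bigr => m _; rewrite mcoeffZ mulrA.
Qed.

Lemma Op0 f : Op 0 f = 0.
Proof. by rewrite -(scale0r 0) OpZ mul0r. Qed.

Lemma OpN P f : Op (- P) f = - Op P f.
Proof. by rewrite -scaleN1r OpZ mulN1r. Qed.

Lemma Op_sum (I : Type) (r : seq I) (p : pred I) (P_ : I -> K) f :
  Op (\sum_(i <- r | p i) P_ i) f = \sum_(i <- r | p i) Op (P_ i) f.
Proof. by apply: (big_morph (Op^~ f)) => [P Q|]; [exact: OpD|exact: Op0]. Qed.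

Lemma OpX m f : Op 'X_[m] f = der_mon m f.
Proof. by rewrite /Op unlock msuppX big_seq1 mcoeffX eqxx mul1r. Qed.

Lemma Op_mulX P i f : Op (P * 'X_i) f = Op P (regfun_der (e_ i) f).
Proof.
elim/mpolyind: P => [|c m P _ _ IHP]; first by rewrite mul0r !Op0.
rewrite mulrDl OpD IHP [in RHS]OpD -scalerAl -mpolyXD; congr (_ + _).
by rewrite [RHS]OpZ [LHS]OpZ !OpX der_monU.
Qed.

Lemma OpC c f : Op c%:MP f = c * f.
Proof. by rewrite -[c%:MP]mulr1 mul_mpolyC OpZ -[1](mpolyX0 n A) OpX der_mon0. Qed.

Lemma OpDr P f g : Op P (f + g) = Op P f + Op P g.
Proof.
have der_monD m f' g' : der_mon m (f' + g') = der_mon m f' + der_mon m g'.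
  rewrite /der_mon; elim: (enum _) => //= i s ->; elim: (m i) => //= k ->.
  by rewrite regfun_derD.
rewrite !(OpE _ (leqnn _)) -big_split; apply: eq_bigr => m _.
by rewrite der_monD mulrDr.
Qed.

Lemma OpZr P a f : Op P (a *: f) = a *: Op P f.
Proof.
have der_monZ m f' : der_mon m (a *: f') = a *: der_mon m f'.
  rewrite /der_mon; elim: (enum _) => //= i s ->; elim: (m i) => //= k ->.
  by rewrite regfun_derZ.
rewrite !(OpE _ (leqnn _)) scaler_sumr; apply: eq_bigr => m _.
by rewrite der_monZ scalerAr.
Qed.

Lemma Op_sumr (I : Type) (r : seq I) (p : pred I) (f_ : I -> A) P :
  Op P (\sum_(i <- r | p i) f_ i) = \sum_(i <- r | p i) Op P (f_ i).
Proof.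
apply: (big_morph (Op P)) => [f g|]; first exact: OpDr.
by have := OpZr P 0 0; rewrite !scale0r.
Qed.

Lemma Op_mul_lin_sym P y f : Op (P * lin_sym y) f = Op P (regfun_der y f).
Proof.
rewrite /lin_sym mulr_sumr Op_sum.
have -> : regfun_der y f = \sum_i y i 0 *: regfun_der (e_ i) f.
  rewrite {1}(matrix_sum_delta y); under eq_bigr => i _ do rewrite big_ord1.
  elim: (index_enum _) => [|i s IHs]; last by rewrite !big_cons regfun_der_lin IHs.
  rewrite !big_nil; have := regfun_der_lin f (-1) 0 0.
  by rewrite scaler0 addr0 scaleN1r addNr.
rewrite Op_sumr; apply: eq_bigr => i _.
by rewrite -scalerAr OpZ Op_mulX OpZr mulr_algl.
Qed.

Lemma regfun_der_Op y P f : regfun_der y (Op P f) = Op (sym_der y P + lin_sym y * P) f.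
Proof.
elim/mpoly_ind_mul: P f => [P Q eP eQ|c|P i eP] f.
- by rewrite [Op (P + Q) f]OpD regfun_derD eP eQ -OpD sym_derD mulrDr addrACA.
- by rewrite OpC regfun_derM OpD sym_derC OpC [lin_sym y * _]mulrC Op_mul_lin_sym OpC.
by rewrite Op_mulX eP sym_derM sym_derX mulr0 addr0 mulrA -mulrDl Op_mulX.
Qed.

Lemma regfun_act_Op w P f : regfun_act w (Op P f) = Op (sym_act w P) (regfun_act w f).
Proof.
elim/mpoly_ind_mul: P f => [P Q eP eQ|c|P i eP] f.
- by rewrite [Op (P + Q) f]OpD rmorphD /= eP eQ -OpD sym_actD.
- by rewrite OpC rmorphM /= sym_actC OpC.
by rewrite Op_mulX eP regfun_der_act sym_actM sym_actX Op_mul_lin_sym.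
Qed.

End Symbols.

Fact adapted_key : unit. Proof. exact: tt. Qed.
Fact coef_act_key : unit. Proof. exact: tt. Qed.
Fact newton_sum_key : unit. Proof. exact: tt. Qed.

(** * Symbols twisted by a power of a linear form *)

Lemma poly_ind_mono (R : nzRingType) (P : {poly R} -> Prop) :
    (forall p q, P p -> P q -> P (p + q)) -> (forall c k, P (c *: 'X^k)) ->
  forall p, P p.
Proof.
move=> PD PX p; rewrite -[p]coefK poly_def; apply: big_ind => //.
by rewrite -(scale0r 'X^0); exact: PX.
Qed.

Section TwistedSymbols.
Variables (F : numClosedFieldType) (W : finGroupType) (n : nat).
Variable rW : mx_representation F [set: W]%SET n.
Hypothesis faithful : mx_faithful rW.
Variable alpha : hyperplane rW -> 'Hom('cV[F]_n, F^o).
Hypothesis ker_alpha : forall H : hyperplane rW, lker (alpha H) = H.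
Variable H : hyperplane rW.
Local Notation h := 'cV[F]_n.
Local Notation A := (regfun rW).
Local Notation K := {mpoly (regfun rW)[n]}.
Local Notation KH := {poly {mpoly (regfun rW)[n]}}.
Local Notation e_ i := (delta_mx i 0 : h).
Local Notation lin_sym := (@lin_sym F W n rW).
Local Notation proj := (proj alpha H).
Local Notation alphaV := (alphaV alpha H).
Local Notation WH := (pt_stab H).
Local Notation wdet := (wdet rW).
Implicit Types (f : A) (w z : W) (y v : h) (P Q c : K) (a : F) (g G : KH) (nu : nat -> F).

Definition const_sym a : K := (a%:A)%:MP.
HB.instance Definition _ := GRing.RMorphism.copy const_sym (@mpolyC n A \o in_alg A).

Lemma const_symD a b : const_sym (a + b) = const_sym a + const_sym b.
Proof. exact: (rmorphD const_sym). Qed.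

Lemma const_symM a b : const_sym (a * b) = const_sym a * const_sym b.
Proof. exact: (rmorphM const_sym). Qed.

Lemma const_symN a : const_sym (- a) = - const_sym a.
Proof. exact: (rmorphN const_sym). Qed.

Lemma const_sym1 : const_sym 1 = 1.
Proof. exact: (rmorph1 const_sym). Qed.

Lemma mul_const_sym a c : const_sym a * c = a%:A *: c.
Proof. by rewrite mul_mpolyC. Qed.

Lemma sym_der_const y c a : sym_der y (c * const_sym a) = sym_der y c * const_sym a.
Proof. by rewrite ![_ * const_sym a]mulrC !mul_const_sym sym_der_alg. Qed.

Lemma sym_der_map_const y c (r : {poly F}) :
  map_poly (sym_der y) (c *: map_poly const_sym r) = sym_der y c *: map_poly const_sym r.
Proof. by apply/polyP => i; rewrite !(coefZ, coef_map) /= sym_der_const. Qed.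

(** Unlike [sym_act], this leaves the variables alone: the stabilizer of a hyperplane
acts trivially on the variables of twisted symbols. *)
Definition coef_act z : K -> K := locked_with coef_act_key (map_mpoly (regfun_act z)).
Lemma coef_act_zmod z : zmod_morphism (coef_act z).
Proof. by rewrite /coef_act unlock => P Q; rewrite raddfB. Qed.
Lemma coef_act_monoid z : monoid_morphism (coef_act z).
Proof. by rewrite /coef_act unlock; split=> [|P Q]; rewrite ?rmorph1 ?rmorphM. Qed.
HB.instance Definition _ z :=
  GRing.isZmodMorphism.Build K K (coef_act z) (coef_act_zmod z).
HB.instance Definition _ z :=
  GRing.isMonoidMorphism.Build K K (coef_act z) (coef_act_monoid z).

Lemma mcoeff_coef_act z P m : (coef_act z P)@_m = regfun_act z P@_m.
Proof. by rewrite /coef_act unlock mcoeff_map_mpoly. Qed.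

Lemma coef_actM z P Q : coef_act z (P * Q) = coef_act z P * coef_act z Q.
Proof. exact: (rmorphM (coef_act z)). Qed.

Lemma coef_actC z f : coef_act z f%:MP = (regfun_act z f)%:MP.
Proof. by rewrite /coef_act unlock map_mpolyC. Qed.

Lemma coef_actZ z f P : coef_act z (f *: P) = regfun_act z f *: coef_act z P.
Proof. by rewrite -!mul_mpolyC coef_actM coef_actC. Qed.

Lemma coef_actX z i : coef_act z 'X_i = 'X_i.
Proof. by rewrite /coef_act unlock map_mpolyX. Qed.

Lemma coef_act_const z a : coef_act z (const_sym a) = const_sym a.
Proof. by rewrite coef_actC regfun_act_alg. Qed.

Lemma coef_act_lin_sym z y : coef_act z (lin_sym y) = lin_sym y.
Proof.
rewrite /lin_sym (raddf_sum (coef_act z)) /=; apply: eq_bigr => i _.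
by rewrite coef_actZ coef_actX regfun_act_alg.
Qed.

Lemma coef_act_map_const z c (r : {poly F}) :
  map_poly (coef_act z) (c *: map_poly const_sym r) =
  coef_act z c *: map_poly const_sym r.
Proof. by apply/polyP => i; rewrite !(coefZ, coef_map) /= coef_actM coef_act_const. Qed.

(** The Newton basis with nodes [nu]. *)
Definition newton nu k : {poly F} := \prod_(0 <= i < k) ('X - (nu i)%:P).

Lemma newtonS nu k : newton nu k.+1 = ('X - (nu k)%:P) * newton nu k.
Proof. by rewrite /newton big_nat_recr //= mulrC. Qed.

Lemma size_newton nu k : size (newton nu k) = k.+1.
Proof. by rewrite size_prod_XsubC size_iota subn0. Qed.

Lemma newton_lead nu k : (newton nu k)`_k = 1.
Proof.
have /monicP := monic_prod_XsubC (index_iota 0 k) xpredT nu.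
by rewrite lead_coefE -/(newton nu k) size_newton.
Qed.

(** The combination of the functions [alpha ^- k * newton nu k] with the coefficients
of [G]. For the nodes [nu k = k] this is the effect on [alpha ^ t] of the operator
whose symbol is [G], read as a polynomial in the transverse derivation. *)
Definition newton_sum nu : KH -> KH := locked_with newton_sum_key (fun G =>
  \sum_(k < size G) (alphaV ^+ k *: G`_k) *: map_poly const_sym (newton nu k)).

Lemma newton_sum_widen nu d G : (size G <= d)%N ->
  newton_sum nu G =
  \sum_(k < d) (alphaV ^+ k *: G`_k) *: map_poly const_sym (newton nu k).
Proof.
move=> Gd; rewrite /newton_sum unlock (big_ord_widen _
  (fun k => (alphaV ^+ k *: G`_k) *: map_poly const_sym (newton nu k)) Gd).
rewrite big_mkcond; apply: eq_bigr => k _; case: ltnP => // /(nth_default 0)->.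
by rewrite scaler0 scale0r.
Qed.

Lemma newton_sumD nu G G' : newton_sum nu (G + G') = newton_sum nu G + newton_sum nu G'.
Proof.
pose d := maxn (size G) (size G').
rewrite !(@newton_sum_widen nu d) ?size_polyD ?leq_maxl ?leq_maxr // -big_split.
by apply: eq_bigr => k _; rewrite coefD scalerDr scalerDl.
Qed.

Lemma newton_sum_mono nu c k :
  newton_sum nu (c *: 'X^k) = (alphaV ^+ k *: c) *: map_poly const_sym (newton nu k).
Proof.
rewrite (@newton_sum_widen nu k.+1); last first.
  by apply: leq_trans (size_scale_leq _ _) _; rewrite size_polyXn.
rewrite big_ord_recr big1 => [|i _] /=.
  by rewrite add0r coefZ coefXn eqxx mulr1.
by rewrite coefZ coefXn ltn_eqF // mulr0 scaler0 scale0r.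
Qed.

Lemma coef_newton_sum nu d G k : (size G <= d)%N ->
  (newton_sum nu G)`_k = \sum_(i < d) alphaV ^+ i *: G`_i * const_sym (newton nu i)`_k.
Proof.
move=> Gd; rewrite (newton_sum_widen _ Gd) coef_sum.
by apply: eq_bigr => i _; rewrite coefZ coef_map.
Qed.

(** The Newton bases are unitriangular, so the top coefficients of [newton_sum nu G]
are independent of [nu]. *)
Lemma mcoeff_newton_sum_top nu G k b :
    (forall i, (k < i)%N -> (G`_i)@_b = 0) ->
  ((newton_sum nu G)`_k)@_b = alphaV ^+ k * (G`_k)@_b.
Proof.
move=> Gb; rewrite (@coef_newton_sum nu (maxn (size G) k.+1)) ?leq_maxl // raddf_sum /=.
have kM : (k < maxn (size G) k.+1)%N by rewrite leq_maxr.
rewrite (bigD1 (Ordinal kM)) //= big1 => [|i ik].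
  by rewrite newton_lead const_sym1 mulr1 addr0 mcoeffZ.
rewrite mulrC mul_const_sym mcoeffZ mcoeffZ; case: (ltngtP i k) => [lt_ik|lt_ki|ei].
- by rewrite nth_default ?size_newton // scale0r mul0r.
- by rewrite Gb // !mulr0.
by rewrite -val_eqE /= ei eqxx in ik.
Qed.

Lemma mul_alphaVX k : alpha_fun alpha H ^+ k * alphaV ^+ k = 1.
Proof. by rewrite -exprMn mul_alphaV // expr1n. Qed.

(** [mcoeff_newton_sum_top] computes the top coefficients, and a descending induction
from the top power of [t] applies. *)
Lemma newton_sum_degree nu G d :
    (forall k b, (d < mdeg b + k)%N -> ((newton_sum nu G)`_k)@_b = 0) ->
  forall k b, (d < mdeg b + k)%N -> (G`_k)@_b = 0.
Proof.
move=> Ed k; have [m] := ubnP (size G - k); elim: m => // m IHm in k *.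
rewrite ltnS => Gkm b db.
have Gb i : (k < i)%N -> (G`_i)@_b = 0.
  move=> ki; have [Gi|iG] := leqP (size G) i; first by rewrite nth_default ?mcoeff0.
  apply: IHm; last by rewrite (leq_trans db) // leq_add2l ltnW.
  by apply: leq_trans Gkm; rewrite ltn_sub2l // (ltn_trans ki).
have := mcoeff_newton_sum_top nu Gb.
rewrite Ed // => /(congr1 ( *%R (alpha_fun alpha H ^+ k))).
by rewrite mulr0 mulrA mul_alphaVX mul1r.
Qed.

(** Splits a symbol along [H]: the variable of [{poly K}] stands for the derivation
transverse to [H], and only derivations along [H] occur in the coefficients. *)
Definition adapted : K -> KH := locked_with adapted_key (mmap (@polyC K \o @mpolyC n A)
  (fun i => (lin_sym (proj (e_ i)))%:P + const_sym (alpha H (e_ i)) *: 'X)).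
Lemma adapted_zmod : zmod_morphism adapted.
Proof. by rewrite /adapted unlock => P Q; rewrite raddfB. Qed.
Lemma adapted_monoid : monoid_morphism adapted.
Proof. by rewrite /adapted unlock; split=> [|P Q]; rewrite ?rmorph1 ?rmorphM. Qed.
HB.instance Definition _ := GRing.isZmodMorphism.Build K KH adapted adapted_zmod.
HB.instance Definition _ := GRing.isMonoidMorphism.Build K KH adapted adapted_monoid.

Lemma adaptedD P Q : adapted (P + Q) = adapted P + adapted Q.
Proof. exact: (raddfD adapted). Qed.

Lemma adaptedM P Q : adapted (P * Q) = adapted P * adapted Q.
Proof. exact: (rmorphM adapted). Qed.

Lemma adaptedC f : adapted f%:MP = f%:MP%:P.
Proof. by rewrite /adapted unlock mmapC. Qed.

Lemma adaptedX i :
  adapted 'X_i = (lin_sym (proj (e_ i)))%:P + const_sym (alpha H (e_ i)) *: 'X.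
Proof. by rewrite /adapted unlock mmapX mmap1U. Qed.

Lemma adaptedZ f P : adapted (f *: P) = f%:MP *: adapted P.
Proof. by rewrite -mul_mpolyC adaptedM adaptedC mul_polyC. Qed.

Lemma adapted_lin_sym y :
  adapted (lin_sym y) = (lin_sym (proj y))%:P + const_sym (alpha H y) *: 'X.
Proof.
pose T v : KH := (lin_sym (proj v))%:P + const_sym (alpha H v) *: 'X.
have TP a u v : T (a *: u + v) = const_sym a *: T u + T v.
  rewrite /T proj_linear lin_symP alphaP const_symD const_symM.
  rewrite scalerDl -scalerA scalerDr -mul_mpolyC polyCD polyCM mul_polyC.
  by rewrite addrACA.
have T0 : T 0 = 0.
  by have := TP (-1) 0 0; rewrite scaler0 addr0 const_symN const_sym1 scaleN1r addNr.
rewrite -/(T y) [in RHS](matrix_sum_delta y) /lin_sym (raddf_sum adapted) /=.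
under [in RHS]eq_bigr => i _ do rewrite big_ord1.
elim: (index_enum _) => [|i s IHs]; first by rewrite !big_nil T0.
by rewrite !big_cons IHs TP adaptedZ adaptedX.
Qed.

(** The splitting loses no information. *)
Lemma horner_adapted P : (adapted P).[lin_sym (coroot alpha H)] = P.
Proof.
apply: (mpoly_rmorph_eq (f := horner_eval (lin_sym (coroot alpha H)) \o adapted)
  (g := idfun)) => [c|i] /=.
  by rewrite /horner_eval adaptedC hornerC.
rewrite /horner_eval adaptedX hornerD hornerC hornerZ hornerX mul_const_sym.
rewrite -lin_symZ -lin_symD.
by rewrite subrK lin_sym_delta.
Qed.

Lemma adapted_degree P k : (msize (adapted P)`_k <= msize P - k)%N.
Proof.
rewrite /adapted unlock; move: k.
apply: (@mmap_graded _ _ _ (@polyC K \o @mpolyC n A) _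
  (fun d G => forall k, msize G`_k <= d - k)%N).
- by move=> d k; rewrite coef0 msize0.
- by move=> d G G' hG hG' k; rewrite coefD msizeD_leq.
- by move=> d e G de hG k; rewrite (leq_trans (hG k)) // leq_sub2r.
- move=> c k /=; rewrite coefC.
  by case: eqP => [->|_]; rewrite ?subn0 msizeC ?leq_b1 ?eqxx.
move=> d G i hG k; rewrite mulrDr coefD mulrC coefCM -scalerAr coefZ coefMX mul_const_sym.
apply: msizeD_leq.
  have [kd|dk] := leqP k d.
    by rewrite subSn // mulrC -[(d - k).+1]addn1 msizeM_leq ?msize_lin_sym.
  have /eqP dk0 : (d - k)%N == 0%N by rewrite subn_eq0 ltnW.
  have := hG k; rewrite dk0 leqn0 msize_poly_eq0 => /eqP->.
  by rewrite mulr0 msize0.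
apply: leq_trans (msizeZ_le _ _) _; case: k => [|k] /=; first by rewrite msize0.
by rewrite subSS.
Qed.

Lemma mcoeff_lin_symX y k b : mdeg b != k -> (lin_sym y ^+ k)@_b = 0.
Proof.
elim: k b => [|k IHk] b bk.
  by rewrite expr0 mcoeff1 -mdeg_eq0 (negbTE bk).
rewrite exprS mcoeffM big1 // => -[b1 b2] /= /eqP eb.
have [e1|b1n] := eqVneq (mdeg b1) 1%N.
  by rewrite IHk ?mulr0 //; apply: contra bk => /eqP e2; rewrite eb mdegD e1 e2.
rewrite [X in X * _](_ : _ = 0) ?mul0r // /lin_sym raddf_sum big1 // => i _ /=.
rewrite mcoeffZ mcoeffX; case: eqP => [e|]; rewrite ?mulr0 //.
by rewrite -e mdeg1 in b1n.
Qed.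

Definition derH y g : KH := map_poly (sym_der y) g.
Definition actH z g : KH := map_poly (coef_act z) g.

Lemma derHD y g g' : derH y (g + g') = derH y g + derH y g'.
Proof. exact: (raddfD (map_poly (sym_der y))). Qed.

Lemma derHM y g g' : derH y (g * g') = derH y g * g' + g * derH y g'.
Proof.
apply/polyP => i; rewrite /derH coefD coef_map !coefM raddf_sum -big_split.
by apply: eq_bigr => j _; rewrite /= sym_derM !coef_map.
Qed.

Lemma derHC y c : derH y c%:P = (sym_der y c)%:P.
Proof. exact: map_polyC. Qed.

Lemma actHD z g g' : actH z (g + g') = actH z g + actH z g'.
Proof. exact: (raddfD (map_poly (coef_act z))). Qed.

(** The conjugate of the derivation along [y] by [alpha ^ t] times an exponential of
the coordinates of [H]. *)
Definition nabla y g : KH :=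
  derH y g + lin_sym (proj y) *: g + ((alpha H y : F) *: alphaV)%:MP *: ('X * g).

Lemma nablaD y g g' : nabla y (g + g') = nabla y g + nabla y g'.
Proof.
rewrite /nabla derHD mulrDr !scalerDr.
rewrite (addrACA (derH y g) (derH y g')).
exact: addrACA.
Qed.

Lemma sym_der_alphaVX y c k : sym_der y (alphaV ^+ k *: c) =
  alphaV ^+ k *: sym_der y c - (k%:R * alpha H y)%:A *: (alphaV ^+ k.+1 *: c).
Proof.
rewrite sym_derZ regfun_der_alphaVX // addrC; congr (_ + _).
by rewrite scalerA mulr_algl scaleNr scaleNr.
Qed.

(** The factor [t - k] is the exponent of [alpha] in [alpha ^ (t - k)], which the
derivation brings down. *)
Lemma nabla_newton_sum nu y c k : nabla y (newton_sum nu (c *: 'X^k)) =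
  newton_sum nu ((sym_der y c + lin_sym (proj y) * c) *: 'X^k) +
  ((alpha H y : F) *: alphaV ^+ k.+1 *: c) *:
     (('X - (const_sym k%:R)%:P) * map_poly const_sym (newton nu k)).
Proof.
rewrite !newton_sum_mono; set R := map_poly const_sym (newton nu k).
set x := alphaV ^+ k *: c.
have -> : nabla y (x *: R) =
    sym_der y x *: R + lin_sym (proj y) *: (x *: R) +
    (alpha H y *: alphaV)%:MP *: ('X * (x *: R)).
  by rewrite /nabla /derH sym_der_map_const.
have -> : lin_sym (proj y) *: (x *: R) = (alphaV ^+ k *: (lin_sym (proj y) * c)) *: R.
  by rewrite scalerA /x -scalerAr.
have eX : ((alpha H y : F) *: alphaV)%:MP * x = ((alpha H y : F) *: alphaV ^+ k.+1) *: c.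
  by rewrite mul_mpolyC /x scalerA -scalerAl exprS.
have -> : (alpha H y *: alphaV)%:MP *: ('X * (x *: R)) =
    ((alpha H y : F) *: alphaV ^+ k.+1 *: c) *: ('X * R).
  by rewrite -scalerAr scalerA eX.
rewrite /x sym_der_alphaVX mulrBl mul_polyC scalerBr scalerBl scalerDr scalerDl.
have -> : ((k%:R * alpha H y)%:A *: (alphaV ^+ k.+1 *: c)) *: R =
    ((alpha H y : F) *: alphaV ^+ k.+1 *: c) *: (const_sym k%:R *: R).
  rewrite [RHS]scalerA [X in _ = X *: R]mulrC mul_const_sym scalerA.
  rewrite [in RHS]scalerA; congr (_ *: c *: R).
  by rewrite !mulr_algl scalerA mulrC.
exact: sub_rearrange.
Qed.

End TwistedSymbols.

(** * The lattice of a hyperplane *)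

Section Lattice.
Variables (F : numClosedFieldType) (W : finGroupType) (n : nat).
Variable rW : mx_representation F [set: W]%SET n.
Hypothesis faithful : mx_faithful rW.
Variable alpha : hyperplane rW -> 'Hom('cV[F]_n, F^o).
Hypothesis ker_alpha : forall H : hyperplane rW, lker (alpha H) = H.
Variable H : hyperplane rW.
Local Notation h := 'cV[F]_n.
Local Notation A := (regfun rW).
Local Notation K := {mpoly (regfun rW)[n]}.
Local Notation KH := {poly {mpoly (regfun rW)[n]}}.
Local Notation e_ i := (delta_mx i 0 : h).
Local Notation lin_sym := (@lin_sym F W n rW).
Local Notation proj := (proj alpha H).
Local Notation alphaV := (alphaV alpha H).
Local Notation no_pole := (no_pole alpha H).
Local Notation WH := (pt_stab H).
Local Notation wdet := (wdet rW).
Local Notation const_sym := (const_sym rW).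
Local Notation newton_sum := (newton_sum alpha H).
Local Notation adapted := (adapted alpha H).
Local Notation nabla := (nabla alpha H).
Implicit Types (f : A) (w z : W) (y v : h) (P Q c : K) (a : F) (g G : KH) (nu : nat -> F).

Lemma scale_const_sym a f c : (a *: f) *: c = f *: (const_sym a * c).
Proof. by rewrite mul_const_sym scalerA mulr_algr. Qed.

Lemma map_newtonS nu k : map_poly const_sym (newton nu k.+1) =
  ('X - (const_sym (nu k))%:P) * map_poly const_sym (newton nu k).
Proof. by rewrite newtonS rmorphM /= rmorphB /= map_polyX map_polyC. Qed.

Lemma actH_newton_sum nu z c k : z \in WH ->
  actH z (newton_sum nu (c *: 'X^k)) =
  newton_sum nu ((const_sym (wdet z ^+ k) * coef_act z c) *: 'X^k).
Proof.
move=> zH; rewrite !newton_sum_mono /actH coef_act_map_const coef_actZ act_alphaVX //.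
by rewrite mul_const_sym scalerA mulr_algr.
Qed.

(** In adapted coordinates the stabilizer only scales the transverse derivation. *)
Lemma adapted_sym_act z P : z \in WH ->
  adapted (sym_act z P) = actH z (adapted P) \Po (const_sym (wdet z) *: 'X).
Proof.
move=> zH; apply: (mpoly_rmorph_eq (f := adapted \o sym_act z)
  (g := comp_poly (const_sym (wdet z) *: 'X) \o map_poly (coef_act z)
          \o adapted)) => [c|i] /=.
  by rewrite sym_actC !adaptedC map_polyC /= coef_actC comp_polyC.
rewrite sym_actX adapted_lin_sym adaptedX proj_pt_stab // alpha_pt_stab //.
rewrite rmorphD /= map_polyC /= coef_act_lin_sym map_polyZ map_polyX /= coef_act_const.
by rewrite comp_polyD comp_polyC comp_polyZ comp_polyX scalerA const_symM mulrC.
Qed.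

(** The polynomial in [t] by which the operator with symbol [P] multiplies [alpha ^ t]
times an exponential of the coordinates of [H]. *)
Definition twisted P : KH := newton_sum (fun i => i%:R) (adapted P).

Lemma twistedD P Q : twisted (P + Q) = twisted P + twisted Q.
Proof. by rewrite /twisted adaptedD newton_sumD. Qed.

Lemma newton_sumZ nu c G : newton_sum nu (c *: G) = c *: newton_sum nu G.
Proof.
elim/poly_ind_mono: G => [G G' eG eG'|c' k].
  by rewrite scalerDr !newton_sumD eG eG' scalerDr.
by rewrite scalerA !newton_sum_mono scalerA -!mul_mpolyC mulrCA.
Qed.

Lemma twistedZ f P : twisted (f *: P) = f%:MP *: twisted P.
Proof. by rewrite /twisted adaptedZ newton_sumZ. Qed.

Lemma twisted1 : twisted 1 = 1.
Proof.
have e1 : 1 = 1 *: 'X^0 :> KH by rewrite expr0 scale1r.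
rewrite /twisted rmorph1 {1}e1 newton_sum_mono expr0 scale1r.
by rewrite /newton big_nil rmorph1 scale1r.
Qed.

Lemma twisted_act z P : z \in WH -> twisted (sym_act z P) = actH z (twisted P).
Proof.
move=> zH; rewrite /twisted adapted_sym_act //.
elim/poly_ind_mono: (adapted P) => [G G' eG eG'|c k].
  rewrite actHD comp_polyD [LHS]newton_sumD [newton_sum _ (G + G')]newton_sumD.
  by rewrite actHD; congr (_ + _).
rewrite actH_newton_sum // /actH map_polyZ map_polyXn comp_polyZ comp_Xn_poly exprZn.
by rewrite scalerA -rmorphXn mulrC.
Qed.

Lemma adapted_sym_der y P : adapted (sym_der y P) = derH y (adapted P).
Proof.
elim/mpoly_ind_mul: P => [P Q eP eQ|c|P i eP].
- by rewrite sym_derD !adaptedD derHD eP eQ.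
- by rewrite sym_derC !adaptedC derHC sym_derC.
rewrite sym_derM sym_derX mulr0 addr0 !adaptedM derHM eP.
suff -> : derH y (adapted 'X_i) = 0 by rewrite mulr0 addr0.
rewrite adaptedX derHD derHC sym_der_lin_sym polyC0 add0r.
have := sym_der_map_const y (const_sym (alpha H (e_ i))) 'X.
rewrite map_polyX /derH => ->.
by rewrite sym_derC regfun_derZ regfun_der1 scaler0 mpolyC0 scale0r.
Qed.

Lemma twisted_nabla y P : twisted (sym_der y P + lin_sym y * P) = nabla y (twisted P).
Proof.
rewrite /twisted adaptedD adaptedM adapted_lin_sym adapted_sym_der.
elim/poly_ind_mono: (adapted P) => [G G' eG eG'|c k].
  rewrite derHD mulrDr addrACA [LHS]newton_sumD [newton_sum _ (G + G')]newton_sumD nablaD.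
  by congr (_ + _).
rewrite nabla_newton_sum // -map_newtonS scale_const_sym -newton_sum_mono.
rewrite -[RHS]newton_sumD; congr (newton_sum _ _).
have -> : derH y (c *: 'X^k) = sym_der y c *: 'X^k.
  by have := sym_der_map_const y c 'X^k; rewrite map_polyXn.
rewrite mulrDl mul_polyC scalerA addrA -scalerDl; congr (_ + _).
by rewrite -scalerAl -scalerAr scalerA exprS.
Qed.

(** The span over the functions without a pole along [H] of the products of
[alpha ^- k] and [newton nu k]. *)
Definition lattice nu g : Prop :=
  exists2 G : KH, (forall k, G`_k \is a mpolyOver n no_pole) & g = newton_sum nu G.

Lemma lattice_mono nu c k : c \is a mpolyOver n no_pole ->
  lattice nu ((alphaV ^+ k *: c) *: map_poly const_sym (newton nu k)).
Proof.
move=> cO; exists (c *: 'X^k); last by rewrite newton_sum_mono.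
by move=> i; rewrite coefZ coefXn; case: (i == k); rewrite ?mulr1 ?mulr0 ?rpred0.
Qed.

Lemma lattice_D nu g g' : lattice nu g -> lattice nu g' -> lattice nu (g + g').
Proof.
move=> [G GO ->] [G' GO' ->]; exists (G + G'); last by rewrite newton_sumD.
by move=> k; rewrite coefD rpredD.
Qed.

Lemma lattice0 nu : lattice nu 0.
Proof.
have := @lattice_mono nu 0 0 (rpred0 _).
by rewrite scaler0 scale0r.
Qed.

Lemma lattice_ind nu (Q : KH -> Prop) :
    (forall g g', Q g -> Q g' -> Q (g + g')) ->
    (forall c k, c \is a mpolyOver n no_pole ->
      Q ((alphaV ^+ k *: c) *: map_poly const_sym (newton nu k))) ->
  forall g, lattice nu g -> Q g.
Proof.
move=> QD QM g [G GO ->]; rewrite (newton_sum_widen _ _ _ (leqnn _)).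
apply: big_ind => // [|k _]; last by apply: QM; exact: GO.
by have := QM 0 0%N (rpred0 _); rewrite scaler0 scale0r.
Qed.

Lemma lattice_Z nu C g :
  C \is a mpolyOver n no_pole -> lattice nu g -> lattice nu (C *: g).
Proof.
move=> CO; elim/lattice_ind => [g1 g2 h1 h2|c k cO].
  by rewrite scalerDr; exact: lattice_D.
by rewrite scalerA -scalerAr; apply: lattice_mono; rewrite rpredM.
Qed.

Lemma no_pole_const_sym a : const_sym a \is a mpolyOver n no_pole.
Proof. by rewrite mpolyOverC no_poleZ // rpred1. Qed.

Lemma no_pole_lin_sym y : lin_sym y \is a mpolyOver n no_pole.
Proof.
apply: rpred_sum => i _; apply: mpolyOverZ; last exact: mpolyOverX.
by rewrite no_poleZ // rpred1.
Qed.

Lemma no_pole_sym_der y c :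
  c \is a mpolyOver n no_pole -> sym_der y c \is a mpolyOver n no_pole.
Proof.
move=> /mpolyOverP cO; apply/mpolyOverP => m.
by rewrite mcoeff_sym_der no_pole_der.
Qed.

Lemma lattice_B nu g g' : lattice nu g -> lattice nu g' -> lattice nu (g - g').
Proof.
move=> gN g'N; rewrite -scaleN1r; apply: lattice_D => //; apply: lattice_Z => //.
by rewrite rpredN rpred1.
Qed.

Lemma lattice_sum nu (I : Type) (r : seq I) (p : pred I) (g_ : I -> KH) :
  (forall i, p i -> lattice nu (g_ i)) -> lattice nu (\sum_(i <- r | p i) g_ i).
Proof. by move=> gN; apply: big_ind => //; [exact: lattice0|exact: lattice_D]. Qed.

Lemma lattice_X nu g : lattice nu g -> lattice nu ('X * g).
Proof.
elim/lattice_ind => [g1 g2 h1 h2|c k cO]; first by rewrite mulrDr; exact: lattice_D.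
set R := map_poly const_sym (newton nu k).
have -> : 'X * (alphaV ^+ k *: c *: R) =
    (alphaV ^+ k.+1 *: ((alpha_fun alpha H)%:MP * c)) *:
      map_poly const_sym (newton nu k.+1) +
    (alphaV ^+ k *: (const_sym (nu k) * c)) *: R.
  rewrite map_newtonS -/R mulrBl scalerBr mul_polyC -scalerAr.
  have -> : alphaV ^+ k.+1 *: ((alpha_fun alpha H)%:MP * c) = alphaV ^+ k *: c.
    by rewrite mul_mpolyC scalerA exprSr -mulrA [alphaV * _]mulrC mul_alphaV // mulr1.
  have -> : (alphaV ^+ k *: (const_sym (nu k) * c)) *: R =
      (alphaV ^+ k *: c) *: (const_sym (nu k) *: R).
    by rewrite scalerA -scalerAl [c * _]mulrC.
  by rewrite subrK.
apply: lattice_D; apply: lattice_mono; rewrite rpredM ?no_pole_const_sym //.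
by rewrite mpolyOverC no_pole_poly.
Qed.

Lemma lattice_mul_poly nu (p : {poly F}) g :
  lattice nu g -> lattice nu (map_poly const_sym p * g).
Proof.
move=> gN; elim/poly_ind: p => [|p a pN]; first by rewrite rmorph0 mul0r; exact: lattice0.
rewrite rmorphD rmorphM /= map_polyX map_polyC mulrDl mulrAC mulrC mul_polyC.
by apply: lattice_D; [exact: lattice_X|apply: lattice_Z; rewrite ?no_pole_const_sym].
Qed.

Lemma no_pole_sub_coef_act z c : z \in WH -> c \is a mpolyOver n no_pole ->
  alphaV *: (c - coef_act z c) \is a mpolyOver n no_pole.
Proof.
move=> zH /mpolyOverP cO; apply/mpolyOverP => m; rewrite mcoeffZ mcoeffB mcoeff_coef_act.
by rewrite -opprB mulrN rpredN no_pole_act_sub.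
Qed.

(** The computation in dimension one. On [alpha ^ (t - k)], the derivation along the
coroot gives the factor [t - k]. The reflection terms only matter modulo functions
vanishing on [H], where the stabilizer acts by a power of the determinant; they
turn this factor into [t - nu k], which leads to the next generator. *)
Lemma dunkl_lattice nu (gam : W -> F) y g :
    (forall k, nu k = k%:R + \sum_(z in WH) gam z * wdet z ^+ k) ->
  lattice nu g ->
  lattice nu (nabla y g -
    \sum_(z in WH) ((alpha H y * gam z : F) *: alphaV)%:MP *: actH z g).
Proof.
move=> nuE; elim/lattice_ind => [g1 g2 h1 h2|c k cO].
  rewrite nablaD (eq_bigr (fun z => ((alpha H y * gam z : F) *: alphaV)%:MP *: actH z g1 +
    ((alpha H y * gam z : F) *: alphaV)%:MP *: actH z g2)) => [|z _].
    by rewrite big_split opprD addrACA; exact: lattice_D.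
  by rewrite actHD scalerDr.
have -> : nabla y ((alphaV ^+ k *: c) *: map_poly const_sym (newton nu k)) =
    nabla y (newton_sum nu (c *: 'X^k)) by rewrite newton_sum_mono.
rewrite nabla_newton_sum // -addrA; apply: lattice_D.
  rewrite newton_sum_mono; apply: lattice_mono; rewrite rpredD ?no_pole_sym_der //.
  by rewrite rpredM ?no_pole_lin_sym.
set R := map_poly const_sym (newton nu k); set x := (_ *: _ *: c).
have -> : 'X - (const_sym k%:R)%:P = ('X - (const_sym (nu k))%:P) +
    \sum_(z in WH) (const_sym (gam z * wdet z ^+ k))%:P :> KH.
  rewrite nuE const_symD polyCD opprD -(rmorph_sum polyC) -(rmorph_sum const_sym) /=.
  by rewrite addrA subrK.
rewrite mulrDl -map_newtonS scalerDr -addrA; apply: lattice_D.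
  rewrite /x scale_const_sym; apply: lattice_mono.
  by rewrite rpredM ?no_pole_const_sym.
rewrite mulr_suml scaler_sumr -sumrB; apply: lattice_sum => z zH.
have -> : x *: ((const_sym (gam z * wdet z ^+ k))%:P * R) -
    ((alpha H y * gam z : F) *: alphaV)%:MP *: actH z ((alphaV ^+ k *: c) *: R) =
  (alphaV ^+ k *: (const_sym (alpha H y * gam z * wdet z ^+ k) *
     (alphaV *: (c - coef_act z c)))) *: R.
  rewrite /actH coef_act_map_const coef_actZ act_alphaVX // !scalerA.
  rewrite mul_polyC [X in X - _]scalerA -scalerBl; congr (_ *: R).
  have eM a f c' : (a *: f) *: c' = const_sym a * f%:MP * c'.
    by rewrite scale_const_sym -mul_mpolyC mulrCA mulrA.
  rewrite /x !eM !const_symM -[(_ *: alphaV)%:MP]mulr1 mul_mpolyC eM const_symM mulr1.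
  rewrite -!mul_mpolyC exprS mpolyCM.
  exact: dunkl_term_identity.
apply: lattice_mono; rewrite rpredM ?no_pole_const_sym //.
exact: no_pole_sub_coef_act.
Qed.

Lemma newton_add nu k m :
  newton nu (k + m) = newton (fun i => nu (k + i)%N) m * newton nu k.
Proof.
rewrite /newton (@big_cat_nat _ _ _ k) ?leq_addr //= mulrC; congr (_ * _).
by rewrite -{1}[k]add0n big_addn addKn; apply: eq_bigr => i _; rewrite addnC.
Qed.

Lemma coef_actA z w P : coef_act z (coef_act w P) = coef_act (z * w) P.
Proof.
apply/mpolyP => m; rewrite [LHS]mcoeff_coef_act [X in regfun_act z X]mcoeff_coef_act.
by rewrite [RHS]mcoeff_coef_act regfun_actA.
Qed.

(** Averaging makes the coefficient of the generator of index [k] semi-invariant, so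
by [no_pole_semi_invariant] it is divisible by [alpha ^ (k mod n_H)]. This leaves a
multiple of the generator whose index is [k] rounded down to a multiple of [n_H]. *)
Lemma lattice_inv_change nu nu' g :
    (forall q, newton nu (#|WH| * q) = newton nu' (#|WH| * q)) ->
    (forall z, z \in WH -> actH z g = g) ->
  lattice nu g -> lattice nu' g.
Proof.
move=> nunu' ginv [G GO eg].
have nH0 : #|WH|%:R != 0 :> F by rewrite pnatr_eq0 -lt0n cardG_gt0.
pose G' k := const_sym (#|WH|%:R^-1) *
  \sum_(z in WH) const_sym (wdet z ^+ k) * coef_act z G`_k.
have eg' : g = \sum_(k < size G)
    (alphaV ^+ k *: G' k) *: map_poly const_sym (newton nu k).
  have -> : g = const_sym (#|WH|%:R^-1) *: \sum_(z in WH) actH z g.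
    rewrite (eq_bigr (fun=> g)) // sumr_const -scaler_nat scalerA.
    rewrite -(rmorph_nat const_sym) -const_symM mulVf // const_sym1 scale1r.
    by [].
  have actg z : z \in WH -> actH z g = \sum_(k < size G)
      (alphaV ^+ k *: (const_sym (wdet z ^+ k) * coef_act z G`_k)) *:
        map_poly const_sym (newton nu k).
    move=> zH; rewrite eg (newton_sum_widen _ _ _ (leqnn _)) /actH raddf_sum.
    apply: eq_bigr => k _ /=.
    by rewrite coef_act_map_const coef_actZ act_alphaVX // scale_const_sym.
  rewrite (eq_bigr _ actg).
  rewrite exchange_big scaler_sumr; apply: eq_bigr => k _.
  by rewrite -scaler_suml -scaler_sumr scalerA -scalerAr.
rewrite eg'; apply: lattice_sum => k _; set r := (k %% #|WH|)%N; set q := (k %/ #|WH|)%N.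
have G'O : alphaV ^+ r *: G' k \is a mpolyOver n no_pole.
  apply/mpolyOverP => m; rewrite mcoeffZ; apply: no_pole_semi_invariant => //.
    have : G' k \is a mpolyOver n no_pole; last by move/mpolyOverP.
    rewrite rpredM ?no_pole_const_sym //; apply: rpred_sum => z zH.
    rewrite rpredM ?no_pole_const_sym //; apply/mpolyOverP => m'.
    by rewrite mcoeff_coef_act no_pole_act //; have /mpolyOverP := GO k.
  move=> z zH; rewrite -mcoeff_coef_act -[_ *: _]mulr_algl -mcoeffZ -mul_const_sym.
  congr (_ @_ m); rewrite /G' coef_actM coef_act_const mulrCA; congr (_ * _).
  rewrite raddf_sum mulr_sumr [RHS](reindex_inj (mulgI z)) /=.
  apply: eq_big => [w|w wH]; first by rewrite groupMl.
  rewrite coef_actM coef_act_const mulrA -const_symM -exprMn -wdetM; congr (_ * _).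
  exact: coef_actA.
have -> : (alphaV ^+ k *: G' k) *: map_poly const_sym (newton nu k) =
    map_poly const_sym (newton (fun i => nu (#|WH| * q + i)%N) r) *
    ((alphaV ^+ (#|WH| * q) *: (alphaV ^+ r *: G' k)) *:
      map_poly const_sym (newton nu' (#|WH| * q))).
  rewrite -scalerAr -rmorphM /= -nunu' -newton_add scalerA -exprD.
  by rewrite [(#|WH| * q)%N]mulnC -divn_eq.
by apply: lattice_mul_poly; exact: lattice_mono.
Qed.

(** Top coefficients do not see the difference between the nodes [nu] of the lattice
and the nodes [k] of [twisted] ([mcoeff_newton_sum_top]). *)
Lemma twisted_top nu P d b : lattice nu (twisted P) -> (msize P <= d.+1)%N ->
  mdeg b = d -> P@_b \in no_pole.
Proof.
move=> [G GO eT] Pd bd.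
have sP k m : (d < mdeg m + k)%N -> ((adapted P)`_k)@_m = 0.
  move=> dm; apply: (msize_leP _ _ (adapted_degree alpha H P k)).
  by rewrite leq_subLR (leq_trans Pd) // addnC.
have Td k m : (d < mdeg m + k)%N -> ((newton_sum nu G)`_k)@_m = 0.
  move=> dm; rewrite -eT mcoeff_newton_sum_top ?sP ?mulr0 // => i ki; apply: sP.
  by rewrite (leq_trans dm) // leq_add2l ltnW.
have Gd := newton_sum_degree ker_alpha Td.
have top k m : mdeg m + k = d -> ((adapted P)`_k)@_m \in no_pole.
  move=> md; have lt i : (k < i)%N -> (d < mdeg m + i)%N.
    by move=> ki; rewrite -md ltn_add2l.
  have eP : alphaV ^+ k * ((adapted P)`_k)@_m = alphaV ^+ k * (G`_k)@_m.
    rewrite -(@mcoeff_newton_sum_top _ _ _ _ alpha H nu G k m) => [|i /lt/Gd //].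
    by rewrite -eT mcoeff_newton_sum_top // => i /lt/sP.
  have /(congr1 ( *%R (alpha_fun alpha H ^+ k))) := eP.
  rewrite !mulrA mul_alphaVX // !mul1r => ->.
  by have /mpolyOverP := GO k.
rewrite -(horner_adapted alpha H P) horner_coef raddf_sum /=; apply: rpred_sum => k _.
rewrite mcoeffM; apply: rpred_sum => -[m1 m2] /= /eqP eb.
have [m2k|m2k] := eqVneq (mdeg m2) k; last by rewrite mcoeff_lin_symX // mulr0 rpred0.
have ed := congr1 mdeg eb; rewrite mdegD in ed.
apply: rpredM; first by apply: top; rewrite -m2k; exact: etrans (esym ed) bd.
have : lin_sym (coroot alpha H) ^+ k \is a mpolyOver n no_pole.
  by rewrite rpredX ?no_pole_lin_sym.
by move/mpolyOverP.
Qed.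

End Lattice.

(** * The spherical subalgebra *)

Section Cherednik.
Variables (F : numClosedFieldType) (W : finGroupType) (n : nat).
Variable rW : mx_representation F [set: W]%SET n.
Hypothesis faithful : mx_faithful rW.
Variable alpha : hyperplane rW -> 'Hom('cV[F]_n, F^o).
Hypothesis ker_alpha : forall H : hyperplane rW, lker (alpha H) = H.
Local Notation h := 'cV[F]_n.
Local Notation A := (regfun rW).
Local Notation K := {mpoly (regfun rW)[n]}.
Local Notation KH := {poly {mpoly (regfun rW)[n]}}.
Local Notation nH H := #|pt_stab H|.
Local Notation e_ i := (delta_mx i 0 : h).
Local Notation lin_sym := (@lin_sym F W n rW).
Local Notation alphaV := (alphaV alpha).
Local Notation wdet := (wdet rW).
Implicit Types (H : hyperplane rW) (f : A) (u w z : W) (y v : h) (P Q : K) (a : F).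

Section FixedParam.
Variable c : param rW.
Arguments c : clear implicits.

Definition gamma H z : F := \sum_(j < nH H) c H j * wdet z ^- j.

(** The numbers [mu k] for which the Dunkl operator maps [alpha ^ (t - k)] to
[t - mu k] times [alpha ^ (t - k - 1)], up to terms of higher order along [H]. *)
Definition exponent H (k : nat) : F :=
  k%:R + \sum_(z in pt_stab H) gamma H z * wdet z ^+ k.

(** Composition with a Dunkl operator, on the symbols of operators restricted to
invariant functions. *)
Definition sym_dunkl y P : K := sym_der y P + lin_sym y * P -
  \sum_H \sum_(z in pt_stab H) ((alpha H y * gamma H z : F) *: alphaV H) *: sym_act z P.

Definition inv_fun f := forall w, regfun_act w f = f.

Lemma dunklE y f : dunkl alpha c y f = regfun_der y f -
  \sum_H \sum_(z in pt_stab H) ((alpha H y * gamma H z : F) *: alphaV H) * regfun_act z f.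
Proof.
rewrite /dunkl; congr (_ - _); apply: eq_bigr => H _.
have nH0 : (nH H)%:R != 0 :> F by rewrite pnatr_eq0 -lt0n cardG_gt0.
rewrite /stab_idem; under eq_bigr => j _ do
  rewrite scalerA mulrAC mulfV // mul1r scaler_sumr.
rewrite exchange_big mulr_sumr; apply: eq_bigr => z _ /=.
under eq_bigr => j _ do rewrite scalerA.
rewrite -scaler_suml -/(gamma H z) -scalerAr -scalerAl scalerA.
by rewrite -scalerAl mulrC.
Qed.

Lemma dunkl_Op y P f : inv_fun f -> dunkl alpha c y (Op P f) = Op (sym_dunkl y P) f.
Proof.
move=> finv; rewrite dunklE regfun_der_Op /sym_dunkl [RHS]OpD OpN Op_sum; congr (_ - _).
apply: eq_bigr => H _; rewrite Op_sum; apply: eq_bigr => z _.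
by rewrite regfun_act_Op finv OpZ.
Qed.

Lemma msize_sub_sym_dunkl y P : (msize (sym_dunkl y P - lin_sym y * P) <= msize P)%N.
Proof.
rewrite /sym_dunkl addrAC addrK; apply: msizeD_leq; first exact: msize_sym_der.
rewrite msizeN; apply: (big_ind (fun Q : K => (msize Q <= msize P)%N)) => [|Q Q'|H _].
- by rewrite msize0.
- exact: msizeD_leq.
apply: (big_ind (fun Q : K => (msize Q <= msize P)%N)) => [|Q Q'|z _].
- by rewrite msize0.
- exact: msizeD_leq.
by apply: leq_trans (msizeZ_le _ _) _; exact: msize_sym_act.
Qed.

Lemma gamma_translate w H H' z : param_inv c -> H' = translate w H :> {vspace h} ->
  gamma H' z = gamma H (z ^ w)%g.
Proof.
move=> cinv eH; have en := esym (card_pt_stab_translate ker_alpha eH).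
rewrite /gamma [LHS](reindex (cast_ord en)) /=; last first.
  by exists (cast_ord (esym en)) => j _; rewrite ?cast_ordK ?cast_ordKV.
by apply: eq_bigr => j _; rewrite (cinv _ _ _ eH j) // wdetJ.
Qed.

(** The translates by [u] occur because group elements in the Dunkl operators permute
the hyperplanes. *)
Definition lattice_sym P : Prop :=
  forall H u, lattice alpha H (exponent H) (twisted alpha H (sym_act u P)).

Lemma lattice_symD P Q : lattice_sym P -> lattice_sym Q -> lattice_sym (P + Q).
Proof. by move=> hP hQ H u; rewrite sym_actD twistedD; apply: lattice_D. Qed.

Lemma lattice_symZ p P : lattice_sym P -> lattice_sym (of_poly rW p *: P).
Proof.
move=> hP H u; rewrite sym_actZ twistedZ; apply: lattice_Z; last exact: hP.
by rewrite mpolyOverC regfun_act_poly no_pole_poly.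
Qed.

Lemma lattice_sym_alg a P : lattice_sym P -> lattice_sym (a%:A *: P).
Proof.
have -> : a%:A = of_poly rW a%:MP :> A by rewrite regfun_scaleE mulr1.
exact: lattice_symZ.
Qed.

Lemma lattice_sym1 : lattice_sym 1.
Proof.
move=> H u; rewrite rmorph1 twisted1.
have := @lattice_mono _ _ _ _ alpha H (exponent H) 1 0 (rpred1 _).
by rewrite expr0 scale1r /newton big_nil rmorph1 scale1r.
Qed.

Lemma lattice_sym_act w P : lattice_sym P -> lattice_sym (sym_act w P).
Proof. by move=> hP H u; rewrite sym_actA; exact: hP. Qed.

Lemma lattice_sym_sum (I : Type) (r : seq I) (p : pred I) (P_ : I -> K) :
  (forall i, p i -> lattice_sym (P_ i)) -> lattice_sym (\sum_(i <- r | p i) P_ i).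
Proof.
move=> hP; apply: big_ind => //; last exact: lattice_symD.
by have := lattice_sym_alg 0 lattice_sym1; rewrite scale0r scale0r.
Qed.

Lemma lattice_symN P : lattice_sym P -> lattice_sym (- P).
Proof. by move=> hP; have := lattice_sym_alg (-1) hP; rewrite scaleN1r scaleN1r. Qed.

Lemma twisted_sum H (I : Type) (r : seq I) (p : pred I) (P_ : I -> K) :
  twisted alpha H (\sum_(i <- r | p i) P_ i) = \sum_(i <- r | p i) twisted alpha H (P_ i).
Proof.
apply: (big_morph (twisted alpha H)) => [P Q|]; first exact: twistedD.
by have := twistedZ alpha H 0 0; rewrite scale0r mpolyC0 scale0r.
Qed.

Lemma twistedB H P Q : twisted alpha H (P - Q) = twisted alpha H P - twisted alpha H Q.
Proof.
have -> : - Q = (-1) *: Q by rewrite scaleN1r.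
by rewrite twistedD twistedZ mpolyCN scaleNr scale1r.
Qed.

(** The translate by [u] of the summand of one hyperplane [H1] is singular along [H];
together with the derivation it is handled by [dunkl_lattice]. The other summands
have no pole along [H]. *)
Lemma lattice_sym_dunkl y P : param_inv c -> lattice_sym P -> lattice_sym (sym_dunkl y P).
Proof.
move=> cinv hP H u.
have [H1 eH1] := translate_exists u^-1 H.
have eH : H = translate u H1 :> {vspace h}.
  apply/vspaceP => v; rewrite /translate eH1 /translate.
  apply/idP/memv_imgP => [vH|[v1 /memv_imgP[v2 v2H ->]]].
    exists (rW u^-1%g *m v); last by rewrite lin_actE rW_mulKV.
    by apply/memv_imgP; exists v => //; rewrite lin_actE.
  by rewrite !lin_actE rW_mulKV => ->.
have [a a0 ea] := alpha_translate ker_alpha eH.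
set g := twisted alpha H (sym_act u P).
have gN : lattice alpha H (exponent H) g := hP H u.
have -> : sym_act u (sym_dunkl y P) =
    sym_der (rW u *m y) (sym_act u P) + lin_sym (rW u *m y) * sym_act u P -
    \sum_(H' : hyperplane rW) \sum_(z in pt_stab H')
      regfun_act u ((alpha H' y * gamma H' z : F) *: alphaV H') *: sym_act (u * z) P.
  rewrite /sym_dunkl sym_actD (raddfN (sym_act u)) /= sym_actD sym_actM.
  rewrite sym_act_lin_sym sym_act_der.
  congr (_ - _); rewrite (raddf_sum (sym_act u)); apply: eq_bigr => H' _ /=.
  rewrite (raddf_sum (sym_act u)); apply: eq_bigr => z _ /=.
  by rewrite sym_actZ sym_actA.
rewrite twistedB twisted_nabla // twisted_sum (bigD1 H1) //= opprD addrA.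
apply: lattice_B.
  have -> : twisted alpha H (\sum_(z in pt_stab H1)
        regfun_act u ((alpha H1 y * gamma H1 z : F) *: alphaV H1) *: sym_act (u * z) P) =
      \sum_(z in pt_stab H)
        ((alpha H (rW u *m y) * gamma H z : F) *: alphaV H)%:MP *: actH z g.
    rewrite (reindex_inj (conjg_inj u)) twisted_sum.
    apply: eq_big => [z|z]; first by rewrite -(pt_stab_translate ker_alpha eH).
    rewrite -(pt_stab_translate ker_alpha eH) => zH.
    rewrite -conjgC -sym_actA twistedZ twisted_act // -/g -(gamma_translate z cinv eH).
    congr (_%:MP *: _); rewrite regfun_actZ (act_alphaV ker_alpha a0 ea) scalerA ea.
    by rewrite mulrC mulrA.
  exact: dunkl_lattice.
apply: lattice_sum => H' neH'; rewrite twisted_sum; apply: lattice_sum => z _.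
rewrite twistedZ; apply: lattice_Z; last exact: hP.
have [H2 eH2] := translate_exists u H'; rewrite mpolyOverC regfun_actZ no_poleZ //.
have [a2 a20 ea2] := alpha_translate ker_alpha eH2.
rewrite (act_alphaV ker_alpha a20 ea2) no_poleZ //; apply: (no_pole_alphaV ker_alpha).
apply: contra_neq neH' => eHH; apply/val_inj/vspaceP => v.
rewrite !(mem_hyperplane ker_alpha) -(alpha_translate_eq0 ker_alpha eH2).
by rewrite -(alpha_translate_eq0 ker_alpha eH) eHH.
Qed.

(** On invariant functions [T] acts on symbols from the left, and it preserves the
symbols with the lattice property because the generators of the Cherednik algebra
do. *)
Lemma cherednik_lift T : param_inv c -> cherednik alpha c T ->
  exists S : K -> K, (forall P f, inv_fun f -> T (Op P f) = Op (S P) f) /\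
    (forall P, lattice_sym P -> lattice_sym (S P)).
Proof.
move=> cinv hT; apply: (hT (fun T => exists S : K -> K,
  (forall P f, inv_fun f -> T (Op P f) = Op (S P) f) /\
  (forall P, lattice_sym P -> lattice_sym (S P)))); split; first split.
- by exists id.
- move=> S T' [S1 [h1 g1]] [S2 [h2 g2]]; exists (fun P => S1 P + S2 P); split.
    by move=> P f finv; rewrite OpD h1 ?h2.
  by move=> P hP; apply: lattice_symD; [exact: g1|exact: g2].
- move=> a T' [S1 [h1 g1]]; exists (fun P => a%:A *: S1 P); split.
    by move=> P f finv; rewrite OpZ h1 // mulr_algl.
  by move=> P hP; apply: lattice_sym_alg; exact: g1.
- move=> S T' [S1 [h1 g1]] [S2 [h2 g2]]; exists (S1 \o S2); split.
    by move=> P f finv /=; rewrite h2 // h1.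
  by move=> P hP; apply: g1; exact: g2.
move=> T' [[[p _ <-]|[w _ <-]]|[y _ <-]].
- exists (fun P => of_poly rW p *: P); split; last by move=> P; exact: lattice_symZ.
  by move=> P f _; rewrite OpZ.
- exists (sym_act w); split; last by move=> P; exact: lattice_sym_act.
  by move=> P f finv; rewrite regfun_act_Op finv.
- exists (sym_dunkl y); split; last by move=> P; exact: lattice_sym_dunkl.
  by move=> P f finv; exact: dunkl_Op.
Qed.

Lemma inv_symmetrizer f : inv_fun (symmetrizer f).
Proof.
move=> w; rewrite /symmetrizer regfun_actZ (raddf_sum (regfun_act w)) /=; congr (_ *: _).
rewrite [RHS](reindex_inj (mulgI w)); apply: eq_bigr => z _.
by rewrite regfun_actA.
Qed.

Let nW0 : #|W|%:R != 0 :> F.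
Proof. by rewrite pnatr_eq0 -lt0n; apply/card_gt0P; exists 1%g. Qed.

Definition sym_avg P : K := (#|W|%:R^-1)%:A *: \sum_(w : W) sym_act w P.

Lemma sym_avg_inv w P : sym_act w (sym_avg P) = sym_avg P.
Proof.
rewrite /sym_avg sym_actZ regfun_act_alg (raddf_sum (sym_act w)) /=; congr (_ *: _).
rewrite [RHS](reindex_inj (mulgI w)); apply: eq_bigr => z _.
by rewrite sym_actA.
Qed.

Lemma sym_avg_id P : (forall w, sym_act w P = P) -> sym_avg P = P.
Proof.
move=> Pinv; rewrite /sym_avg (eq_bigr (fun=> P)) // sumr_const.
have eW : #|W|%:R = #|W|%:R%:A :> A by rewrite scaler_nat.
rewrite (_ : #|xpredT| = #|W|) // -scaler_nat eW scalerA mulr_algl scalerA mulVf //.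
by rewrite !scale1r.
Qed.

Lemma sym_avgD P Q : sym_avg (P + Q) = sym_avg P + sym_avg Q.
Proof.
rewrite /sym_avg -scalerDr -big_split; congr (_ *: _).
by apply: eq_bigr => w _; rewrite sym_actD.
Qed.

Lemma msize_sym_avg P : (msize (sym_avg P) <= msize P)%N.
Proof.
apply: leq_trans (msizeZ_le _ _) _.
apply: (big_ind (fun Q : K => (msize Q <= msize P)%N)) => [|Q Q'|w _].
- by rewrite msize0.
- exact: msizeD_leq.
exact: msize_sym_act.
Qed.

Lemma lattice_sym_avg P : lattice_sym P -> lattice_sym (sym_avg P).
Proof.
move=> hP; apply: lattice_sym_alg; apply: lattice_sym_sum => w _.
exact: lattice_sym_act.
Qed.

Lemma symmetrizer_Op P f : inv_fun f -> symmetrizer (Op P f) = Op (sym_avg P) f.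
Proof.
move=> finv; rewrite /symmetrizer /sym_avg OpZ Op_sum mulr_algl; congr (_ *: _).
by apply: eq_bigr => w _; rewrite regfun_act_Op finv.
Qed.

Lemma op_subalgebra_cherednik : op_subalgebra (cherednik alpha c).
Proof. exact: generated_algebraP. Qed.

Lemma symmetrizer_cherednik : cherednik alpha c (@symmetrizer _ _ _ rW).
Proof.
have [_ _ CZ _] := op_subalgebra_cherednik.
apply: (CZ _ (fun f => \sum_(w : W) regfun_act w f)).
apply: op_subalgebra_sum => [|w _]; first exact: op_subalgebra_cherednik.
by apply: generated_algebra_gen; left; right; exists w.
Qed.

(** The symbols of the operators on invariant functions that the Cherednik algebra
induces. *)
Definition realized Q : Prop := lattice_sym Q /\
  exists2 T, cherednik alpha c T & forall f, inv_fun f -> T f = Op Q f.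

Lemma realizedD P Q : realized P -> realized Q -> realized (P + Q).
Proof.
have [_ CD _ _] := op_subalgebra_cherednik.
move=> [gP [T hT eT]] [gQ [T' hT' eT']]; split; first exact: lattice_symD.
by exists (fun f => T f + T' f) => [|f finv]; [exact: CD|rewrite OpD eT ?eT'].
Qed.

Lemma realizedZ p P : realized P -> realized (of_poly rW p *: P).
Proof.
have [_ _ _ CC] := op_subalgebra_cherednik.
move=> [gP [T hT eT]]; split; first exact: lattice_symZ.
exists ((fun f => of_poly rW p * f) \o T) => [|f finv]; last by rewrite /= OpZ eT.
by apply: CC => //; apply: generated_algebra_gen; left; left; exists p.
Qed.

Lemma realized0 : realized 0.
Proof.
have [C1 _ CZ _] := op_subalgebra_cherednik.
split; first by have := lattice_sym_alg 0 lattice_sym1; rewrite scale0r scale0r.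
by exists (fun f => 0 *: f) => [|f _]; [exact: CZ C1|rewrite scale0r Op0].
Qed.

Lemma realized1 : realized 1.
Proof.
have [C1 _ _ _] := op_subalgebra_cherednik.
by split; [exact: lattice_sym1|exists id => // f _; rewrite -mpolyC1 OpC mul1r].
Qed.

Lemma realized_sym_dunkl y P : param_inv c -> realized P -> realized (sym_dunkl y P).
Proof.
have [_ _ _ CC] := op_subalgebra_cherednik.
move=> cinv [gP [T hT eT]]; split; first exact: lattice_sym_dunkl.
exists (dunkl alpha c y \o T) => [|f finv]; last by rewrite /= eT // dunkl_Op.
by apply: CC => //; apply: generated_algebra_gen; right; exists y.
Qed.

Lemma realized_sym_avg P : realized P -> realized (sym_avg P).
Proof.
have [_ _ _ CC] := op_subalgebra_cherednik.
move=> [gP [T hT eT]]; split; first exact: lattice_sym_avg.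
exists (@symmetrizer _ _ _ rW \o T) => [|f finv]; last by rewrite /= eT // symmetrizer_Op.
by apply: CC => //; exact: symmetrizer_cherednik.
Qed.

Lemma realized_monomial m : param_inv c ->
  exists2 Q, realized Q & (msize (Q - 'X_[m]) <= mdeg m)%N.
Proof.
move=> cinv; elim/mnm_ind: m => [|m' i [Q rQ Qm]].
  by exists 1; [exact: realized1|rewrite mpolyX0 subrr msize0].
exists (sym_dunkl (e_ i) Q); first exact: realized_sym_dunkl.
rewrite addmC mpolyXD mdegD mdeg1 add1n.
have -> : sym_dunkl (e_ i) Q - 'X_i * 'X_[m'] =
    (sym_dunkl (e_ i) Q - lin_sym (e_ i) * Q) + (Q - 'X_[m']) * lin_sym (e_ i).
  by rewrite lin_sym_delta [_ * 'X_i]mulrC mulrBr addrA subrK.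
apply: msizeD_leq; last by rewrite msizeM_lin_sym.
apply: leq_trans (msize_sub_sym_dunkl _ _) _.
rewrite -[Q](subrK 'X_[m']); apply: msizeD_leq; first exact: leq_trans Qm _.
by rewrite msizeX.
Qed.

(** By induction on the order. The top coefficients of [P] are polynomials, so a
combination of products of Dunkl operators has the same ones; averaging it over
[W] makes the difference with [P] invariant. *)
Lemma lattice_sym_realized P :
    param_inv c -> lattice_sym P -> (forall w, sym_act w P = P) ->
  realized P.
Proof.
move=> cinv; have [d] := ubnP (msize P); elim: d => // d IHd in P *.
rewrite ltnS => Pd gP Pinv.
case: d => [|d] in IHd Pd *.
  by move: Pd; rewrite leqn0 msize_poly_eq0 => /eqP->; exact: realized0.
have top m : mdeg m = d -> exists p, P@_m = of_poly rW p.
  move=> md; apply: (no_pole_all_poly ker_alpha) => H.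
  apply: (twisted_top ker_alpha _ Pd md) => //.
  by rewrite -[P](sym_act1); exact: gP.
have [Q rQ QP] : exists2 Q, realized Q &
    (msize (Q - \sum_(m <- msupp P | mdeg m == d) P@_m *: 'X_[m]) <= d)%N.
  elim: (msupp P) => [|m r [Q rQ Qr]].
    by exists 0; [exact: realized0|rewrite big_nil subrr msize0].
  rewrite big_cons; case: eqP => [md|_]; last by exists Q.
  have [p ->] := top m md; have [Qm rQm Qmd] := realized_monomial m cinv.
  exists (of_poly rW p *: Qm + Q); first by apply: realizedD => //; exact: realizedZ.
  rewrite opprD addrACA -scalerBr; apply: msizeD_leq => //.
  by apply: leq_trans (msizeZ_le _ _) _; rewrite -md.
have PQ : (msize (P - Q) <= d)%N.
  rewrite -[P - Q](subrK (\sum_(m <- msupp P | mdeg m == d) P@_m *: 'X_[m])).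
  set S := \sum_(m <- msupp P | _) _.
  have -> : P - Q - S + S = (P - S) - (Q - S).
    by rewrite opprB addrA subrK subrK.
  apply: msizeD_leq; last by rewrite msizeN.
  apply/msize_leP => m dm; rewrite mcoeffB /S.
  have [md|md] := eqVneq (mdeg m) d; last first.
    rewrite (msize_leP _ _ Pd) 1?ltn_neqAle 1?eq_sym ?md // sub0r raddf_sum.
    rewrite big1 ?oppr0 //.
    move=> m' /eqP m'd; rewrite /= mcoeffZ mcoeffX; case: eqP => [e|]; rewrite ?mulr0 //.
    by rewrite -m'd e eqxx in md.
  apply/eqP; rewrite subr_eq0; apply/eqP.
  have eP : P@_m = \sum_(m' <- msupp P) P@_m' * (m' == m)%:R.
    rewrite {1}[P]mpolyE raddf_sum; apply: eq_bigr => m' _.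
    by rewrite /= mcoeffZ mcoeffX.
  rewrite eP raddf_sum [RHS]big_mkcond; apply: eq_bigr => m' _.
  rewrite /= mcoeffZ mcoeffX; have [->|_] := eqVneq m' m; first by rewrite md eqxx.
  by rewrite mulr0; case: ifP.
have rA := realized_sym_avg rQ.
have eA : P - sym_avg Q = sym_avg (P - Q).
  have avgN : sym_avg (- Q) = - sym_avg Q.
    rewrite /sym_avg -scalerN -sumrN; congr (_ *: _).
    by apply: eq_bigr => w _; rewrite rmorphN.
  by rewrite sym_avgD avgN (sym_avg_id Pinv).
rewrite -[P](subrK (sym_avg Q)); apply: realizedD => //; apply: IHd.
- by rewrite eA ltnS; apply: leq_trans (msize_sym_avg _) PQ.
- by apply: lattice_symD => //; apply: lattice_symN; case: rA.
by move=> w; rewrite eA sym_avg_inv.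
Qed.

Lemma sphericalP X : param_inv c -> spherical alpha c X <->
  exists P, [/\ lattice_sym P, (forall w, sym_act w P = P)
    & X = fun f => Op P (symmetrizer f)].
Proof.
move=> cinv; split=> [[T hT <-]|[P [gP Pinv ->]]].
  have [S [eS gS]] := cherednik_lift cinv hT.
  exists (sym_avg (S 1)); split.
    by apply: lattice_sym_avg; apply: gS; exact: lattice_sym1.
    by move=> w; rewrite sym_avg_inv.
  apply: funext => f; have finv := inv_symmetrizer f.
  rewrite -symmetrizer_Op // -eS //=; congr (symmetrizer (T _)).
  by rewrite -mpolyC1 OpC mul1r.
have [_ [T hT eT]] := lattice_sym_realized cinv gP Pinv.
exists T => //; apply: funext => f; have finv := inv_symmetrizer f.
by rewrite /= eT // symmetrizer_Op // sym_avg_id.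
Qed.

(** By orthogonality of the powers of the determinant on the stabilizer. *)
Lemma exponentE H k : exponent H k = k%:R +
  (nH H)%:R * c H (Ordinal (ltn_pmod k (cardG_gt0 (pt_stab_group H)))).
Proof.
rewrite /exponent; congr (_ + _); rewrite /gamma.
under eq_bigr => z _ do rewrite mulr_suml.
rewrite exchange_big /=; set j0 := Ordinal _.
have e (j : 'I_(nH H)) :
    \sum_(z in pt_stab H) c H j * wdet z ^- j * wdet z ^+ k =
    if j == j0 then (nH H)%:R * c H j else 0.
  have -> : \sum_(z in pt_stab H) c H j * wdet z ^- j * wdet z ^+ k =
      c H j * \sum_(z in pt_stab H) wdet z ^+ (k + (nH H - j)).
    rewrite mulr_sumr; apply: eq_bigr => z zH; rewrite -mulrA; congr (_ * _).
    rewrite mulrC exprD; congr (_ * _).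
    apply: (mulfI (expf_neq0 j (wdet_neq0 rW z))).
    by rewrite mulfV ?expf_neq0 ?wdet_neq0 // -exprD subnKC ?(wdet_expn zH) // ltnW.
  rewrite (sum_wdet_exp faithful ker_alpha) -val_eqE /=.
  have -> : (nH H %| k + (nH H - j))%N = (j == (k %% nH H)%N :> nat).
    have jn := ltn_ord j; rewrite addnBA; last exact: ltnW.
    rewrite -(eqn_mod_dvd (nH H)); last by rewrite (leq_trans (ltnW jn)) ?leq_addl.
    by rewrite modnDr (modn_small jn) eq_sym.
  by case: ifP => _; rewrite ?mulr0 // mulrC.
under eq_bigr => j _ do rewrite e.
by rewrite -big_mkcond big_pred1_eq.
Qed.

End FixedParam.

Lemma lattice_sym_change c c' P :
    (forall H q, newton (exponent c H) (nH H * q) = newton (exponent c' H) (nH H * q)) ->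
    (forall w, sym_act w P = P) ->
  lattice_sym c P -> lattice_sym c' P.
Proof.
move=> ecc' Pinv gP H u.
apply: (lattice_inv_change faithful ker_alpha (ecc' H)); last exact: gP.
by move=> z zH; rewrite -twisted_act // !Pinv.
Qed.

Section DotAction.
Variables (c : param rW) (s : perm_family rW).
Arguments c : clear implicits.
Arguments s : clear implicits.

Lemma newton_exponent_dot_act H q :
  newton (exponent c H) (nH H * q) = newton (exponent (dot_act s c) H) (nH H * q).
Proof.
elim: q => [|q IHq]; first by rewrite muln0 /newton !big_nil.
rewrite mulnS addnC !newton_add IHq; congr (_ * _).
have newtonE c' : newton (fun i => exponent c' H (nH H * q + i)%N) (nH H) =
    \prod_(j < nH H) ('X - ((nH H * q)%:R + (nH H)%:R * (c' H j + @rho F W n rW H j))%:P).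
  rewrite /newton big_mkord; apply: eq_bigr => j _; rewrite exponentE.
  set j' := Ordinal _; have -> : j' = j.
    by apply: val_inj; rewrite /= mulnC modnMDl modn_small.
  have nH0 : (nH H)%:R != 0 :> F by rewrite pnatr_eq0 -lt0n cardG_gt0.
  rewrite /rho mulrDr [(nH H)%:R * (_ / _)]mulrC divfK //.
  by rewrite natrD -addrA [j%:R + _]addrC.
rewrite !newtonE (reindex_inj (@perm_inj _ (s H)^-1%g)) /=; apply: eq_bigr => j _.
by rewrite /dot_act /perm_act subrK.
Qed.

Lemma dot_act_inv : param_inv c -> perm_family_inv s -> param_inv (dot_act s c).
Proof.
move=> cinv sinv w H H' eH j j' ejj'.
have en := esym (card_pt_stab_translate ker_alpha eH).
have es : (s H')^-1%g j' = cast_ord en ((s H)^-1%g j).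
  apply: (@perm_inj _ (s H')); rewrite permKV; apply: val_inj.
  by rewrite /= (sinv _ _ _ eH ((s H)^-1%g j)) //= permKV ejj'.
have rhoE (i : 'I_(nH H)) (i' : 'I_(nH H')) : i' = i :> nat ->
    @rho F W n rW H' i' = @rho F W n rW H i.
  by rewrite /rho => ->; congr (_ / _%:R).
rewrite /dot_act /perm_act es (rhoE _ _ ejj') (rhoE ((s H)^-1%g j) (cast_ord _ _)) //.
by congr (_ + _ - _); apply: (cinv _ _ _ eH).
Qed.

Theorem spherical_dot_act : param_inv c -> perm_family_inv s ->
  spherical alpha c = spherical alpha (dot_act s c).
Proof.
move=> cinv sinv; have c'inv := dot_act_inv cinv sinv.
apply/seteqP; split=> X.
  move=> /(sphericalP X cinv)[P [gP Pinv eX]].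
  apply/(sphericalP X c'inv); exists P; split=> //.
  apply: lattice_sym_change gP => // H q.
  exact: newton_exponent_dot_act.
move=> /(sphericalP X c'inv)[P [gP Pinv eX]].
apply/(sphericalP X cinv); exists P; split=> //; apply: lattice_sym_change gP => // H q.
exact/esym/newton_exponent_dot_act.
Qed.

End DotAction.

End Cherednik.

Theorem theorem1p3 (R : realType) (W : finGroupType) (n : nat)
    (rW : mx_representation R[i] [set: W]%SET n)
    (hrefl : reflection_group rW) (hirr : irreducible_action rW)
    (alpha : hyperplane rW -> 'Hom('cV[R[i]]_n, R[i]^o))
    (halpha : forall H : hyperplane rW, lker (alpha H) = H)
    (c : param rW) (hc : param_inv c)
    (g : perm_family rW) (hg : perm_family_inv g) :
  spherical alpha c = spherical alpha (dot_act g c).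
Proof. by case: hrefl => faithful _; exact: spherical_dot_act. Qed.
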